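(* Let $R$ be a commutative noetherian ring. The following are equivalent: (i) $R$ is a Gorenstein ring of dimension at most one. (ii) Every torsionless $R$-module is reflexive. (iii) Every torsionless $R$-module $M$ is trace in its double dual $M^{**}$, via the natural map $\varepsilon_M:M\to M^{**}$. If $R$ is also a domain, these conditions are equivalent to: (iv) Every torsionless $R$-module is trace in some $\mathcal{R}$-preenvelope (of it) up to isomorphism, where $\mathcal{R}$ is the class of reflexive $R$-modules.
   Context: For an $R$-module $M$, $M^*=\operatorname{Hom}_R(M,R)$, and $\varepsilon_M:M\to M^{**}=(M^* )^*$ is the natural evaluation map sending $m$ to $(\psi\mapsto\psi(m))$. A finitely generated $R$-module $M$ is torsionless if $\varepsilon_M$ is an injection, and reflexive if $\varepsilon_M$ is an isomorphism (both notions are for finitely generated modules). $\mathcal{R}$ denotes the full subcategory of reflexive $R$-modules. For $R$-modules $M,X$, the trace module of $M$ in $X$ is $\tau_M(X)=\sum_{\alpha\in\operatorname{Hom}_R(M,X)}\alpha(M)\subseteq X$. A submodule $M\subseteq X$ is a trace submodule of $X$ if $M=\tau_N(X)$ for some $R$-module $N$. For an injective $R$-homomorphism $\iota:M\to X$, $M$ is trace in $X$ via $\iota$ if $\operatorname{Im}(\iota)$ is a trace submodule of $X$. $M$ is trace in $X$ up to isomorphism if there exists an injection $\iota:M\to X$ such that $\operatorname{Im}(\iota)$ is a trace submodule of $X$. For a class $\mathcal{V}$ of $R$-modules, a $\mathcal{V}$-preenvelope of $M$ is an $R$-homomorphism $\varphi:M\to V$ with $V\in\mathcal{V}$ such that for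 any $\psi:M\to V'$ with $V'\in\mathcal{V}$ there exists $\alpha:V\to V'$ with $\alpha\varphi=\psi$. *)

(* Defs.v *)
From HB Require Import structures.
From mathcomp Require Import all_boot all_order all_algebra generic_quotient ring.
From mathcomp Require Import all_classical.
(* for the eqType and choiceType instances on [{linear U -> V | s}] *)
From mathcomp Require Import prodnormedzmodule.

Set Implicit Arguments.
Unset Strict Implicit.
Unset Printing Implicit Defensive.

Import GRing.Theory.
Local Open Scope classical_set_scope.
Local Open Scope quotient_scope.
Local Open Scope ring_scope.

Section HomZmodule.
Variables (R : pzRingType) (M N : lmodType R).
Implicit Types f g h : {linear M -> N}.

Lemma linear_ext f g : f =1 g -> f = g.
Proof.
move=> fg; have {fg} : (f : M -> N) = g by apply/funext.
case: f g => [f [[f1] [f2]]] [g [[g1] [g2]]] /= fg.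
case: _ / fg in g1 g2 *.
by rewrite (Prop_irrelevance f1 g1) (Prop_irrelevance f2 g2).
Qed.

Definition hom_zero : {linear M -> N} := \0.
Definition hom_opp f : {linear M -> N} := \- f.
Definition hom_add f g : {linear M -> N} := f \+ g.

Lemma hom_addA : associative hom_add.
Proof. by move=> f g h; apply: linear_ext => x /=; rewrite addrA. Qed.

Lemma hom_addC : commutative hom_add.
Proof. by move=> f g; apply: linear_ext => x /=; rewrite addrC. Qed.

Lemma hom_add0 : left_id hom_zero hom_add.
Proof. by move=> f; apply: linear_ext => x /=; rewrite add0r. Qed.

Lemma hom_addN : left_inverse hom_zero hom_opp hom_add.
Proof. by move=> f; apply: linear_ext => x /=; rewrite addNr. Qed.

HB.instance Definition _ := GRing.isZmodule.Build {linear M -> N}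
  hom_addA hom_addC hom_add0 hom_addN.

End HomZmodule.

Section HomLmodule.
Variables (R : comPzRingType) (M N : lmodType R).
Implicit Types f g : {linear M -> N}.

Definition hom_scale (a : R) f : {linear M -> N} := a \*: f.

Lemma hom_scaleA a b f : hom_scale a (hom_scale b f) = hom_scale (a * b) f.
Proof. by apply: linear_ext => x /=; rewrite scalerA. Qed.

Lemma hom_scale1 : left_id 1 hom_scale.
Proof. by move=> f; apply: linear_ext => x /=; rewrite scale1r. Qed.

Lemma hom_scaleDr : right_distributive hom_scale +%R.
Proof. by move=> a f g; apply: linear_ext => x /=; rewrite scalerDr. Qed.

Lemma hom_scaleDl f : {morph hom_scale^~ f : a b / a + b}.
Proof. by move=> a b; apply: linear_ext => x /=; rewrite scalerDl. Qed.

HB.instance Definition _ := GRing.Zmodule_isLmodule.Build R {linear M -> N}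
  hom_scaleA hom_scale1 hom_scaleDr hom_scaleDl.

End HomLmodule.

Definition dual_module (R : comPzRingType) (M : lmodType R) : lmodType R :=
  {linear M -> R^o}.

Section Biduality.
Variables (R : comPzRingType) (M : lmodType R).

Definition evaluation (m : M) (psi : dual_module M) : R^o :=
  (psi : {linear M -> R^o}) m.

Lemma evaluation_linear m : linear (evaluation m).
Proof. by []. Qed.

HB.instance Definition _ m :=
  GRing.isLinear.Build R (dual_module M) R^o _ (evaluation m)
    (evaluation_linear m).

Definition biduality (m : M) : dual_module (dual_module M) :=
  (evaluation m : {linear dual_module M -> R^o}).

Lemma biduality_linear : linear biduality.
Proof.
by move=> a x y; apply: linear_ext => psi; rewrite /= /evaluation linearP.
Qed.

HB.instance Definition _ :=
  GRing.isLinear.Build R M (dual_module (dual_module M)) _ biduality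
    biduality_linear.

End Biduality.

Section Finiteness.
Variables (R : pzRingType) (M : lmodType R).

Definition is_submodule (N : set M) : Prop :=
  N 0 /\ forall (a : R) (x y : M), N x -> N y -> N (a *: x + y).

Definition generated (s : seq M) : set M :=
  [set x | exists c : 'I_(size s) -> R, x = \sum_(i < size s) c i *: s`_i].

Definition finitely_generated : Prop := exists s : seq M, generated s = setT.

End Finiteness.

Definition torsionless (R : comPzRingType) (M : lmodType R) : Prop :=
  finitely_generated M /\ injective (@biduality R M).

Definition reflexive_module (R : comPzRingType) (M : lmodType R) : Prop :=
  finitely_generated M /\ bijective (@biduality R M).

Section Trace.
Variable R : pzRingType.
Implicit Types M N X : lmodType R.

Definition trace_module M X : set X :=
  [set x | exists (n : nat) (alpha : 'I_n -> {linear M -> X}) (m : 'I_n -> M),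
             x = \sum_(i < n) alpha i (m i)].
Arguments trace_module M X _ : clear implicits.

Definition trace_submodule X (Y : set X) : Prop :=
  exists N : lmodType R, Y = trace_module N X.

Definition trace_via M X (iota : {linear M -> X}) : Prop :=
  injective iota /\ trace_submodule (range iota).

Definition trace_up_to_iso M X : Prop :=
  exists iota : {linear M -> X}, trace_via iota.

Definition preenvelope (V : lmodType R -> Prop) M X
    (phi : {linear M -> X}) : Prop :=
  V X /\ forall (X' : lmodType R) (psi : {linear M -> X'}), V X' ->
    exists alpha : {linear X -> X'}, alpha \o phi =1 psi.

End Trace.

Section Ideals.
Variable R : comPzRingType.

Definition is_ideal (I : set R) : Prop := is_submodule (I : set R^o).

Definition is_prime_ideal (p : set R) : Prop :=
  [/\ is_ideal p, ~ p 1 & forall x y, p (x * y) -> p x \/ p y].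

Definition is_maximal_ideal (m : set R) : Prop :=
  [/\ is_ideal m, ~ m 1
    & forall J : set R, is_ideal J -> m `<=` J -> J = m \/ J = setT].

Lemma maximal_is_prime (m : set R) : is_maximal_ideal m -> is_prime_ideal m.
Proof.
move=> [[m0 mS] m1 mmax]; split=> // x y mxy.
have mD u v : m u -> m v -> m (u + v).
  by move=> mu mv; rewrite -[u]mul1r; apply: mS.
have mM a u : m u -> m (a * u).
  by move=> mu; rewrite -[a * u]addr0; apply: mS.
pose J : set R := [set z | exists a b, m b /\ z = a * x + b].
have JI : is_ideal J.
  split; first by exists 0, 0; rewrite mul0r addr0.
  move=> c _ _ [a [b [mb ->]]] [a' [b' [mb' ->]]].
  exists (c * a + a'), (c * b + b'); split; first by apply/mD/mb'/mM.
  by rewrite /GRing.scale /=; ring.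
have mJ : m `<=` J by move=> b mb; exists 0, b; rewrite mul0r add0r.
case: (mmax J JI mJ) => [Jm|JT].
  left; rewrite -Jm; exists 1, 0.
  by rewrite mul1r addr0.
have [a [b [mb e]]] : J 1 by rewrite JT.
right; rewrite -[y]mul1r e mulrDl -mulrA.
by apply: (mD _ _ (mM _ _ mxy)); rewrite mulrC; apply: mM.
Qed.

Record prime_ideal := PrimeIdeal {
  prime_ideal_set :> set R;
  prime_idealP : is_prime_ideal prime_ideal_set }.

Definition noetherian : Prop :=
  forall I : set R, is_ideal I -> exists s : seq R^o, I = generated s.

Definition krull_dim_le (n : nat) : Prop :=
  forall (k : nat) (p : 'I_k.+1 -> prime_ideal),
    (forall i j : 'I_k.+1, (i < j)%N -> p i `<` p j) -> (k <= n)%N.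

Definition is_domain : Prop := 1 != 0 :> R /\ GRing.integral_domain_axiom R.

End Ideals.

Section Localization.
Variables (R : comPzRingType) (S : mulrClosed R).

Definition denominator : Type := {s : R | s \in S}.
HB.instance Definition _ := Choice.on denominator.

Implicit Types (x y z : R * denominator) (s t : denominator).

Definition den1 : denominator := exist _ 1 (rpred1 S).
Definition den_mul s t : denominator :=
  exist _ (val s * val t) (rpredM (valP s) (valP t)).

Definition loc_equiv x y : bool :=
  `[< exists t, val t * (x.1 * val y.2 - y.1 * val x.2) = 0 >].

Lemma loc_equiv_refl : reflexive loc_equiv.
Proof. by move=> x; apply/asboolP; exists den1; rewrite subrr mulr0. Qed.

Lemma loc_equiv_sym : symmetric loc_equiv.
Proof.
move=> x y; apply/asboolP/asboolP => -[t e]; exists t.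
  by rewrite -opprB mulrN e oppr0.
by rewrite -opprB mulrN e oppr0.
Qed.

Lemma loc_equiv_trans : transitive loc_equiv.
Proof.
move=> y x z /asboolP[t e] /asboolP[u f]; apply/asboolP.
exists (den_mul (den_mul t u) y.2) => /=.
have -> : val t * val u * val y.2 * (x.1 * val z.2 - z.1 * val x.2) =
    val u * val z.2 * (val t * (x.1 * val y.2 - y.1 * val x.2)) +
    val t * val x.2 * (val u * (y.1 * val z.2 - z.1 * val y.2)) by ring.
by rewrite e f !mulr0 addr0.
Qed.

Canonical loc_equiv_equiv :=
  EquivRel loc_equiv loc_equiv_refl loc_equiv_sym loc_equiv_trans.

Definition localization : Type := {eq_quot loc_equiv}.
HB.instance Definition _ : EqQuotient _ loc_equiv localization :=
  EqQuotient.on localization.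
HB.instance Definition _ := Choice.on localization.

Definition pre_add x y : R * denominator :=
  (x.1 * val y.2 + y.1 * val x.2, den_mul x.2 y.2).
Definition pre_opp x : R * denominator := (- x.1, x.2).
Definition pre_mul x y : R * denominator := (x.1 * y.1, den_mul x.2 y.2).

Definition loc_zero : localization := lift_cst localization (0, den1).
Canonical pi_loc_zero_morph := PiConst loc_zero.
Definition loc_one : localization := lift_cst localization (1, den1).
Canonical pi_loc_one_morph := PiConst loc_one.
Definition loc_add := lift_op2 localization pre_add.
Definition loc_opp := lift_op1 localization pre_opp.
Definition loc_mul := lift_op2 localization pre_mul.

Lemma loc_eqP x y :
  reflect (exists t, val t * (x.1 * val y.2 - y.1 * val x.2) = 0)
          (x == y %[mod localization]).
Proof. by rewrite eqmodE; apply: asboolP. Qed.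

Lemma loc_repr x :
  exists t, val t * ((repr (\pi_localization x)).1 * val x.2 -
                     x.1 * val (repr (\pi_localization x)).2) = 0.
Proof. by apply/loc_eqP; rewrite reprK. Qed.

Lemma pi_loc_add : {morph \pi : x y / pre_add x y >-> loc_add x y}.
Proof.
move=> x y; unlock loc_add; apply/esym/eqP/loc_eqP.
have [t] := loc_repr x; set x' := repr _ => e.
have [u] := loc_repr y; set y' := repr _ => f.
exists (den_mul t u) => /=.
rewrite [LHS](_ : _ =
  val u * val y.2 * val y'.2 * (val t * (x'.1 * val x.2 - x.1 * val x'.2)) +
  val t * val x.2 * val x'.2 * (val u * (y'.1 * val y.2 - y.1 * val y'.2))).
  by rewrite e f !mulr0 addr0.
by rewrite /=; ring.
Qed.
Canonical pi_loc_add_morph := PiMorph2 pi_loc_add.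

Lemma pi_loc_opp : {morph \pi : x / pre_opp x >-> loc_opp x}.
Proof.
move=> x; unlock loc_opp; apply/esym/eqP/loc_eqP.
have [t] := loc_repr x; set x' := repr _ => e; exists t => /=.
by rewrite !mulNr -opprD mulrN e oppr0.
Qed.
Canonical pi_loc_opp_morph := PiMorph1 pi_loc_opp.

Lemma pi_loc_mul : {morph \pi : x y / pre_mul x y >-> loc_mul x y}.
Proof.
move=> x y; unlock loc_mul; apply/esym/eqP/loc_eqP.
have [t] := loc_repr x; set x' := repr _ => e.
have [u] := loc_repr y; set y' := repr _ => f.
exists (den_mul t u) => /=.
rewrite [LHS](_ : _ =
  val u * y'.1 * val y.2 * (val t * (x'.1 * val x.2 - x.1 * val x'.2)) +
  val t * x.1 * val x'.2 * (val u * (y'.1 * val y.2 - y.1 * val y'.2))).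
  by rewrite e f !mulr0 addr0.
by rewrite /=; ring.
Qed.
Canonical pi_loc_mul_morph := PiMorph2 pi_loc_mul.

Lemma loc_addA : associative loc_add.
Proof.
elim/quotW=> x; elim/quotW=> y; elim/quotW=> z; rewrite !piE.
by apply/eqP/loc_eqP; exists den1 => /=; ring.
Qed.

Lemma loc_addC : commutative loc_add.
Proof.
elim/quotW=> x; elim/quotW=> y; rewrite !piE.
by apply/eqP/loc_eqP; exists den1 => /=; ring.
Qed.

Lemma loc_add0 : left_id loc_zero loc_add.
Proof.
elim/quotW=> x; rewrite !piE.
by apply/eqP/loc_eqP; exists den1 => /=; ring.
Qed.

Lemma loc_addN : left_inverse loc_zero loc_opp loc_add.
Proof.
elim/quotW=> x; rewrite !piE.
by apply/eqP/loc_eqP; exists den1 => /=; ring.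
Qed.

HB.instance Definition _ := GRing.isZmodule.Build localization
  loc_addA loc_addC loc_add0 loc_addN.

Lemma loc_mulA : associative loc_mul.
Proof.
elim/quotW=> x; elim/quotW=> y; elim/quotW=> z; rewrite !piE.
by apply/eqP/loc_eqP; exists den1 => /=; ring.
Qed.

Lemma loc_mulC : commutative loc_mul.
Proof.
elim/quotW=> x; elim/quotW=> y; rewrite !piE.
by apply/eqP/loc_eqP; exists den1 => /=; ring.
Qed.

Lemma loc_mul1 : left_id loc_one loc_mul.
Proof.
elim/quotW=> x; rewrite !piE.
by apply/eqP/loc_eqP; exists den1 => /=; ring.
Qed.

Lemma loc_mulDl : left_distributive loc_mul +%R.
Proof.
elim/quotW=> x; elim/quotW=> y; elim/quotW=> z.
rewrite -![_ + _]/(loc_add _ _) !piE.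
by apply/eqP/loc_eqP; exists den1 => /=; ring.
Qed.

HB.instance Definition _ := GRing.Zmodule_isComPzRing.Build localization
  loc_mulA loc_mulC loc_mul1 loc_mulDl.

End Localization.

Section LocalizationAtPrime.
Variables (R : comPzRingType) (p : prime_ideal R).

Definition prime_complement : {pred R} := fun x => x \notin (p : set R).

Lemma prime_complement_mulr_closed : mulr_closed prime_complement.
Proof.
have [_ p1 pM] := prime_idealP p; split.
  by rewrite unfold_in; apply: contra_notN p1 => /set_mem.
move=> x y px py; rewrite unfold_in; apply/negP => /set_mem /pM [] /mem_set.
  exact/negP.
exact/negP.
Qed.

HB.instance Definition _ :=
  GRing.isMulClosed.Build R prime_complement prime_complement_mulr_closed.

Definition localization_at : comPzRingType := localization prime_complement.

End LocalizationAtPrime.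

Section InjectiveDimension.
Variable A : pzRingType.

Definition injective_module (E : lmodType A) : Prop :=
  forall (M N : lmodType A) (f : {linear M -> N}) (g : {linear M -> E}),
    injective f -> exists h : {linear N -> E}, h \o f =1 g.

Definition exact_at (M N P : lmodType A)
    (f : {linear M -> N}) (g : {linear N -> P}) : Prop :=
  range f = [set y | g y = 0].

(* An injective resolution [0 -> M -> I 0 -> I 1 -> ...] with [I i = 0] for
   [i > n]. *)
Definition injective_dim_le (M : lmodType A) (n : nat) : Prop :=
  exists (I : nat -> lmodType A) (e : {linear M -> I 0%N})
         (d : forall i, {linear I i -> I i.+1}),
    [/\ forall i, injective_module (I i),
        injective e,
        exact_at e (d 0%N),
        forall i, exact_at (d i) (d i.+1)
      & forall i, (n < i)%N -> forall x : I i, x = 0].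

Definition finite_injective_dim (M : lmodType A) : Prop :=
  exists n, injective_dim_le M n.

End InjectiveDimension.

(* By [maximal_is_prime], [p] ranges over all maximal ideals. *)
Definition gorenstein (R : comPzRingType) : Prop :=
  forall p : prime_ideal R, is_maximal_ideal p ->
    finite_injective_dim (localization_at p)^o.

(* Main.v *)
From HB Require Import structures.
Require Import Defs.
From mathcomp Require Import all_boot all_order all_algebra generic_quotient ring.
From mathcomp Require Import all_classical.

Set Implicit Arguments.
Unset Strict Implicit.
Unset Printing Implicit Defensive.

Import Order.TTheory GRing.Theory Num.Theory.
Local Open Scope classical_set_scope.
Local Open Scope ring_scope.

(* All Ext groups are handled through matrices: a chain of matrices exact on row
   vectors is a free resolution, and Ext^(k+1) vanishes when transposition keeps
   such a chain exact.  Both (i) and (ii) amount to Ext^2(-, R) = 0 on finitely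
   generated modules.

   If K is torsionless, K* is the kernel of a map of finite free modules, so
   Ext^2 = 0 makes every functional on K* extend to the free module, i.e. come
   from K.  Conversely, N = ker(R^c -> R^d) is the dual of the torsionless module
   R^c / N^perp; reflexivity of the latter extends functionals from N to R^c.

   From Ext^2 = 0, the injectivity of E/R for an embedding of R in an injective E
   bounds the injective dimension of the localizations, and Nakayama's lemma
   applied to Hom and Ext^1 of the R/q along a chain of three primes bounds the
   dimension.  Conversely, over a localization of finite injective dimension
   Ext^n = 0 for large n, and one descends: if Ext^(n+1) = Ext^(n+2) = ... = 0
   with n >= 2, then X = Ext^n(-, R) satisfies Hom(X, R) = Ext^1(X, R) = 0, which
   in dimension at most one forces X = 0.

   For (iii) and (iv), apply the hypothesis to M x R: a trace submodule of X is
   stable under maps from itself to X, and the maps R -> X reach all of X. *)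

(** * Submodules and noetherian rings *)

Section Submodules.
Variables (R : pzRingType) (M : lmodType R).
Implicit Types (N : set M) (x y : M) (s : seq M).

Lemma submodule0 N : is_submodule N -> N 0.
Proof. by case. Qed.

Lemma submoduleD N x y : is_submodule N -> N x -> N y -> N (x + y).
Proof. by move=> [_ NP] Nx Ny; rewrite -[x]scale1r; apply: NP. Qed.

Lemma submoduleZ N a x : is_submodule N -> N x -> N (a *: x).
Proof. by move=> [N0 NP] Nx; rewrite -[a *: x]addr0; apply: NP. Qed.

Lemma submoduleN N x : is_submodule N -> N x -> N (- x).
Proof. by move=> NS Nx; rewrite -scaleN1r; apply: submoduleZ. Qed.

Lemma submoduleB N x y : is_submodule N -> N x -> N y -> N (x - y).
Proof. by move=> NS Nx Ny; apply: submoduleD => //; apply: submoduleN. Qed.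

Lemma submodule_sum N (I : finType) (F : I -> M) :
  is_submodule N -> (forall i, N (F i)) -> N (\sum_i F i).
Proof.
move=> NS NF; apply: big_ind => //; first exact: submodule0.
by move=> x y; apply: submoduleD.
Qed.

Lemma generated_submodule s : is_submodule (generated s).
Proof.
split; first by exists (fun=> 0); rewrite big1 // => i _; rewrite scale0r.
move=> a _ _ [c ->] [d ->]; exists (fun i => a * c i + d i).
rewrite scaler_sumr -big_split /=; apply: eq_bigr => i _.
by rewrite scalerDl scalerA.
Qed.

Lemma generated_nil : generated [::] = [set 0 : M].
Proof.
apply/seteqP; split=> [x [c ->]|_ ->]; first by rewrite big_ord0.
by exists (fun=> 0); rewrite big_ord0.
Qed.

Lemma generated_cons x s y :
  generated (x :: s) y <-> exists a z, generated s z /\ y = a *: x + z.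
Proof.
split=> [[c ->]|[a [z [[c ->] ->]]]].
  rewrite big_ord_recl /=; exists (c ord0), (\sum_i c (lift ord0 i) *: s`_i).
  by split=> //; exists (fun i => c (lift ord0 i)).
exists (fun i => if unlift ord0 i is Some j then c j else a).
rewrite big_ord_recl unlift_none; congr (_ + _); apply: eq_bigr => i _ /=.
by have -> : unlift ord0 (lift ord0 i) = Some i by rewrite liftK.
Qed.

Lemma generated_min s N : is_submodule N -> {in s, forall x, N x} ->
  generated s `<=` N.
Proof.
move=> NS; elim: s => [|x s IHs] sN y; first by rewrite generated_nil => ->;
  apply: submodule0.
move=> /generated_cons[a [z [sz ->]]]; apply: NS.2; first by apply: sN;
  rewrite mem_head.
by apply: IHs => // t ts; apply: sN; rewrite inE ts orbT.
Qed.

Lemma mem_generated s x : x \in s -> generated s x.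
Proof.
elim: s => // y s IHs; rewrite inE => /predU1P[->|xs]; apply/generated_cons.
  exists 1, 0; split; first exact: submodule0 (generated_submodule s).
  by rewrite scale1r addr0.
by exists 0, x; rewrite scale0r add0r; split=> //; apply: IHs.
Qed.

Lemma generated_sub s t : {subset s <= t} -> generated s `<=` generated t.
Proof.
move=> st; apply: generated_min; first exact: generated_submodule.
by move=> x /st; apply: mem_generated.
Qed.

End Submodules.

(** A map on a submodule is encoded as a total function, linear on [N] and arbitrary elsewhere, so
    that a submodule needs no type of its own. *)
Definition linear_on (R : pzRingType) (M E : lmodType R) (N : set M)
    (f : M -> E) : Prop :=
  forall a x y, N x -> N y -> f (a *: x + y) = a *: f x + f y.

Section LinearOn.
Variables (R : pzRingType) (M E : lmodType R) (N : set M) (f : M -> E).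
Hypotheses (NS : is_submodule N) (fl : linear_on N f).

Lemma linear_on0 : f 0 = 0.
Proof.
have N0 := submodule0 NS.
by have := fl (-1) N0 N0; rewrite scaler0 addr0 scaleN1r addNr.
Qed.

Lemma linear_onZ a x : N x -> f (a *: x) = a *: f x.
Proof.
by move=> Nx; have := fl a Nx (submodule0 NS); rewrite !addr0 linear_on0 addr0.
Qed.

Lemma linear_onD x y : N x -> N y -> f (x + y) = f x + f y.
Proof. by move=> Nx Ny; have := fl 1 Nx Ny; rewrite !scale1r. Qed.

Lemma linear_onN x : N x -> f (- x) = - f x.
Proof. by move=> Nx; rewrite -scaleN1r linear_onZ // scaleN1r. Qed.

Lemma linear_onB x y : N x -> N y -> f (x - y) = f x - f y.
Proof.
by move=> Nx Ny; rewrite linear_onD // ?linear_onN //; apply: submoduleN.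
Qed.

Lemma linear_on_sum (I : finType) (F : I -> M) : (forall i, N (F i)) ->
  f (\sum_i F i) = \sum_i f (F i).
Proof.
move=> NF.
suff [] : N (\sum_i F i) /\ f (\sum_i F i) = \sum_i f (F i) by [].
apply: (big_ind2 (fun x y => N x /\ f x = y)).
- by split; [apply: submodule0|apply: linear_on0].
- move=> x _ y _ [Nx <-] [Ny <-].
  by split; [apply: submoduleD|apply: linear_onD].
- by [].
Qed.

End LinearOn.

Section NoetherianModules.
Variable R : comPzRingType.
Hypothesis Rnoeth : noetherian R.

(* Induction on the number of coordinates: split off the ideal of first
   coordinates. *)
Lemma noetherian_rV n (N : set 'rV[R]_n) :
  is_submodule N -> exists s : seq 'rV[R]_n, N = generated s.
Proof.
elim: n => [|n IHn] in N *; move=> NS.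
  exists [::]; rewrite generated_nil; apply/seteqP; split=> [x _|_ ->].
    by apply/rowP; case.
  exact: submodule0.
pose I : set R := [set a | exists2 x, N x & x ord0 ord0 = a].
have IS : is_ideal I.
  split; first by exists 0; [apply: submodule0|rewrite mxE].
  move=> a _ _ [x Nx <-] [y Ny <-]; exists (a *: x + y); first exact: NS.2.
  by rewrite !mxE.
pose N' : set 'rV[R]_n := [set x | N (row_mx (0 : 'rV_1) x : 'rV_(1 + n))].
have N'S : is_submodule N'.
  split; first by rewrite /N' /= row_mx0; apply: submodule0.
  move=> a x y Nx Ny; rewrite /N' /=.
  have -> : row_mx (0 : 'rV_1) (a *: x + y) = a *: row_mx 0 x + row_mx 0 y.
    by rewrite scale_row_mx add_row_mx scaler0 addr0.
  exact: NS.2.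
have [s sE] := IHn _ N'S; have [t tE] := Rnoeth IS.
(* [h] lifts each element of [I] to a row of [N] with that first coordinate; its values off [I] are
   irrelevant. *)
have /choice[h hP] (a : R) : exists x : 'rV[R]_n.+1, I a -> N x /\ x ord0 ord0 = a.
  by case: (pselect (I a)) => [[x ? ?]|?]; [exists x|exists 0].
pose i0 x : 'rV[R]_n.+1 := (row_mx (0 : 'rV_1) x : 'rV_(1 + n)).
exists ([seq h a | a <- t] ++ [seq i0 x | x <- s]).
apply/seteqP; split; last first.
  apply: generated_min => // x; rewrite mem_cat => /orP[] /mapP[y yin ->].
    by have [] := hP y _; rewrite ?tE //; apply: mem_generated.
  by have : N' y by rewrite sE; apply: mem_generated.
set G := generated _; have GS : is_submodule G := generated_submodule _.
move=> x Nx.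
(* [y] combines lifts of the generators of [I] so as to match the first coordinate of [x]; the
   difference [x - y] then comes from [N']. *)
have [y [Ny Gy xy]] : exists y, [/\ N y, G y & y ord0 ord0 = x ord0 ord0].
  have : I (x ord0 ord0) by exists x.
  have htG a : a \in t -> G (h a).
    by move=> ain; apply: mem_generated; rewrite mem_cat map_f.
  rewrite tE => -[c ->]; exists (\sum_(i < size t) c i *: h t`_i).
  have hti (i : 'I_(size t)) : N (h t`_i) /\ (h t`_i) ord0 ord0 = t`_i.
    by apply: hP; rewrite tE; apply/mem_generated/mem_nth.
  split; first by apply: submodule_sum => // i; apply: submoduleZ => //;
    case: (hti i).
    by apply: submodule_sum => // i; apply: submoduleZ => //; apply/htG/mem_nth.
  rewrite summxE; apply: eq_bigr => i _; rewrite mxE.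
  by case: (hti i) => _ ->.
rewrite -[x](subrK y); apply: submoduleD => //.
have Nz : N (x - y) by apply: submoduleB.
have zE : x - y = i0 (@rsubmx _ 1 1 n (x - y)).
  rewrite -[LHS](@hsubmxK _ 1 1 n) /i0.
  suff -> : @lsubmx _ 1 1 n (x - y) = 0 by [].
  apply/rowP => i; rewrite (ord1 i) !mxE.
  have -> : lshift n (0 : 'I_1) = ord0 :> 'I_n.+1 by apply: val_inj.
  by rewrite xy subrr.
move: zE; set w := rsubmx _ => zE.
have : N' w by rewrite /N' /= -/(i0 _) -zE.
rewrite zE sE => -[c ->].
have -> : i0 (\sum_(i < size s) c i *: s`_i) = \sum_(i < size s) c i *: i0 s`_i.
  apply: (big_ind2 (fun u v => i0 u = v)) => [|u _ v _ <- <-|i _].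
  - by rewrite /i0 row_mx0.
  - apply: esym; apply: etrans (@add_row_mx _ 1 1 n 0 u 0 v) _.
    by rewrite addr0.
  - apply: esym; apply: etrans (@scale_row_mx _ 1 1 n (c i) 0 s`_i) _.
    by rewrite scaler0.
apply: submodule_sum => // i; apply: submoduleZ => //.
by apply: mem_generated; rewrite mem_cat map_f ?orbT //; apply: mem_nth.
Qed.

(** Zorn's lemma: the union of a chain with a nonempty member is an ideal, hence finitely generated,
    and one member of the chain contains all the generators and so equals the union. *)
Lemma noetherian_maximal (F : set R -> Prop) (J0 : set R) :
  (forall J, F J -> is_ideal J) -> F J0 ->
  exists J, [/\ F J, J0 `<=` J & forall J', F J' -> J `<=` J' -> J' = J].
Proof.
move=> Fideal FJ0.
(* The case [J = set0] makes the empty chain admissible. *)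
pose P (J : set R) := J = set0 \/ F J /\ J0 `<=` J.
have [C CP Ctot|J [PJ Jmax]] := @Zorn_bigcup R P.
  have [[J [CJ J1]]|C0] := pselect (exists J, C J /\ J !=set0); last first.
    left; rewrite -subset0 => x [J CJ Jx]; apply: C0.
    by exists J; split=> //; exists x.
  have CI K : C K -> K !=set0 -> F K /\ J0 `<=` K.
    by move=> /CP[->|//] [].
  have [FJ J0J] := CI _ CJ J1.
  pose U := \bigcup_(X in C) X.
  have cover (x y : R) : U x -> U y -> exists K, [/\ C K, K x & K y].
    move=> [K CK Kx] [L CL Ly]; have [KL|LK] := Ctot _ _ CK CL.
      by exists L; split=> //; apply: KL.
    by exists K; split=> //; apply: LK.
  have UI : is_ideal U.
    split; first by exists J => //; apply: (submodule0 (Fideal _ FJ)).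
    move=> a x y Ux Uy; have [K [CK Kx Ky]] := cover _ _ Ux Uy.
    have [FK _] := CI _ CK (ex_intro _ _ Kx).
    by exists K => //; apply: (Fideal _ FK).2.
  have [s sE] := Rnoeth UI.
  have [K [CK [Kne sK]]] : exists K, C K /\ K !=set0 /\ {in s, forall x, K x}.
    have : {in s, forall x, U x} by move=> x xs; rewrite sE; apply: mem_generated.
    elim: (s) => [_|x r IHr xrU]; first by exists J.
    have [K [CK [Kne rK]]] := IHr (fun y yr => xrU y (mem_behead (s := x :: r) yr)).
    have [L CL Lx] := xrU x (mem_head _ _).
    have [KL|LK] := Ctot _ _ CK CL.
      exists L; split=> //; split; first by exists x.
      by move=> y; rewrite inE => /predU1P[->//|/rK /KL].
    exists K; split=> //; split=> //.
    by move=> y; rewrite inE => /predU1P[->|/rK//]; apply: LK.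
  have [FK J0K] := CI _ CK Kne.
  have UK : U = K.
    apply/seteqP; split; last by move=> x Kx; exists K.
    by rewrite sE; apply: (@generated_min R R^o s K (Fideal _ FK)).
  by right; rewrite -/U UK.
have [FJ J0J] : F J /\ J0 `<=` J.
  case: PJ => // J0'; exfalso;
    apply: (Jmax J0 _ (or_intror (conj FJ0 (@subset_refl _ J0)))).
  rewrite J0'; split; first exact: sub0set.
  by move=> /(_ 0 (submodule0 (Fideal _ FJ0))).
exists J; split=> // J' FJ' JJ'; apply: contrapT => ne.
apply: (Jmax J' _ (or_intror (conj FJ' (subset_trans J0J JJ')))).
split=> // J'J; apply: ne; exact/seteqP.
Qed.

End NoetherianModules.

(** * Nakayama, associated primes and Ext^1(R/J, R) *)

Section IdealTheory.
Variable R : comPzRingType.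
Implicit Types (I J p q : set R) (a b s t x y : R).

Lemma ideal0 J : is_ideal J -> J 0.
Proof. exact: submodule0. Qed.

Lemma idealD J x y : is_ideal J -> J x -> J y -> J (x + y).
Proof. exact: (@submoduleD R R^o). Qed.

Lemma idealB J x y : is_ideal J -> J x -> J y -> J (x - y).
Proof. exact: (@submoduleB R R^o). Qed.

Lemma idealM J a x : is_ideal J -> J x -> J (a * x).
Proof. exact: (@submoduleZ R R^o). Qed.

Lemma ideal_ofP J : J 0 -> (forall x y, J x -> J y -> J (x + y)) ->
  (forall a x, J x -> J (a * x)) -> is_ideal J.
Proof. by move=> J0 JD JM; split=> // a x y Jx Jy; apply: JD => //; apply: JM. Qed.

Lemma prime_ideal_ideal p : is_prime_ideal p -> is_ideal p.
Proof. by case. Qed.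

Lemma prime_notM p x y : is_prime_ideal p -> ~ p x -> ~ p y -> ~ p (x * y).
Proof. by move=> [_ _ pM] px py /pM[]. Qed.

Definition colon J y : set R := [set a | J (a * y)].
Definition adjoin J y : set R := [set z | exists a b, J b /\ z = a * y + b].
Definition annihilator a : set R := [set b | b * a = 0].

Lemma colon_ideal J y : is_ideal J -> is_ideal (colon J y).
Proof.
move=> JI; apply: ideal_ofP => [|a b|a b]; rewrite /colon /=.
- by rewrite mul0r; apply: ideal0.
- by move=> ? ?; rewrite mulrDl; apply: idealD.
- by move=> ?; rewrite -mulrA; apply: idealM.
Qed.

Lemma sub_colon J y : is_ideal J -> J `<=` colon J y.
Proof. by move=> JI b Jb; rewrite /colon /= mulrC; apply: idealM. Qed.

Lemma adjoin_ideal J y : is_ideal J -> is_ideal (adjoin J y).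
Proof.
move=> JI; apply: ideal_ofP.
- by exists 0, 0; split; [apply: ideal0|rewrite mul0r addr0].
- move=> _ _ [a [b [Jb ->]]] [c [d [Jd ->]]].
  by exists (a + c), (b + d); split; [apply: idealD|ring].
- move=> c _ [a [b [Jb ->]]].
  by exists (c * a), (c * b); split; [apply: idealM|ring].
Qed.

Lemma sub_adjoin J y : J `<=` adjoin J y.
Proof. by move=> b Jb; exists 0, b; rewrite mul0r add0r. Qed.

Lemma mem_adjoin J y : is_ideal J -> adjoin J y y.
Proof. by move=> JI; exists 1, 0; rewrite mul1r addr0; split;
  first exact: ideal0. Qed.

Lemma annihilatorE a : annihilator a = colon [set 0] a.
Proof. by []. Qed.

Lemma zero_ideal : is_ideal ([set 0] : set R).
Proof. by split=> // a _ _ -> ->; rewrite scaler0 addr0. Qed.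

Lemma annihilator_ideal a : is_ideal (annihilator a).
Proof. exact: (colon_ideal a zero_ideal). Qed.

(** This is Nakayama's lemma for the image of [generated s] in [M/L] localized at [p], with
    denominators cleared. Each step of the induction solves the relation of the head generator for
    it modulo [L] and eliminates it. *)
Lemma nakayama (M : lmodType R) (p : set R) x t (s : seq M) (L : set M) :
    is_prime_ideal p -> p x -> is_submodule L -> ~ p t ->
    (forall m, generated s m -> exists2 m', generated s m' & L (t *: m - x *: m')) ->
  exists2 t', ~ p t' & forall m, generated s m -> L (t' *: m).
Proof.
move=> pp px LS; have pI := prime_ideal_ideal pp.
elim: s t => [|y s IHs] t pt ht.
  exists t => // m; rewrite generated_nil => ->; rewrite scaler0; exact: submodule0.
have genS := generated_submodule s.
have [m /generated_cons[a [z [zs ->]]] yL] :=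
  ht y (mem_generated (mem_head _ _)).
(* The coefficient that [y] gets when [t *: y = x *: (a *: y + z)] modulo [L] is solved for [y]. *)
pose u := t - x * a.
have pu : ~ p u.
  move=> pu; apply: pt; rewrite -[t](subrK (x * a)); apply: idealD => //.
  by rewrite mulrC; apply: idealM.
have uy : L (u *: y - x *: z).
  move: yL; rewrite scalerDr scalerA opprD addrA.
  by rewrite -scalerBl.
have [] := IHs (u * t).
- exact: prime_notM.
- move=> m' m's; have [|_ /generated_cons[b [z' [z's ->]]] mL] := ht m'.
    by apply/generated_cons; exists 0, m'; rewrite scale0r add0r.
  (* The relation of [m'] is multiplied by [u], and [u *: y] is replaced by [x *: z] modulo [L],
     which leaves only tail generators. *)
  exists ((b * x) *: z + u *: z').
    by apply: submoduleD => //; apply: submoduleZ.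
  have -> : (u * t) *: m' - x *: ((b * x) *: z + u *: z') =
      u *: (t *: m' - x *: (b *: y + z')) + (x * b) *: (u *: y - x *: z).
    have zmodE (A B C D : M) : A - (D + C) = (A - (B + C)) + (B - D).
      by rewrite [B + C]addrC (opprD C B) !addrA addrNK -addrA -opprD [C + D]addrC.
    rewrite !(scalerDr, scalerN, scalerA) -!(mulrA x b x).
    rewrite (mulrC x u) (mulrC (x * b) u) (mulrA u x b).
    exact: zmodE.
  by apply: submoduleD => //; apply: submoduleZ.
move=> t2 pt2 t2L; exists (t2 * u); first exact: prime_notM.
move=> _ /generated_cons[b [z' [z's ->]]].
rewrite scalerDr; apply: submoduleD => //; last first.
  by rewrite [t2 * u]mulrC -scalerA; apply: submoduleZ => //; apply: t2L.
rewrite scalerA mulrC -scalerA; apply: submoduleZ => //.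
rewrite -scalerA -[u *: y](subrK (x *: z)) scalerDr; apply: submoduleD => //.
  exact: submoduleZ.
by rewrite scalerA mulrC -scalerA; apply: submoduleZ => //; apply: t2L.
Qed.

Definition hom_on J (phi : R -> R) : Prop := @linear_on R R^o R^o J phi.

(* [ext1_killed s J] says that [s] annihilates [Ext^1(R/J, R)], which is the
   cokernel of [R -> Hom(J, R)]. *)
Definition ext1_killed s J : Prop :=
  forall phi : R -> R, hom_on J phi ->
    exists c, forall j, J j -> s * phi j = c * j.

Lemma idealZ J (phi : R -> R) a x : is_ideal J -> hom_on J phi ->
  J x -> phi (a * x) = a * phi x.
Proof. by move=> JI h; apply: (@linear_onZ R R^o R^o J phi JI h a x). Qed.

Lemma ext1_killed_mem s J : is_ideal J -> J s -> ext1_killed s J.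
Proof.
move=> JI Js phi phil; exists (phi s) => j Jj.
by rewrite -(idealZ s JI phil Jj) mulrC (idealZ j JI phil Js) mulrC.
Qed.

(* The long exact sequence of [0 -> R/(J : y) -> R/J -> R/(J + Ry) -> 0]. *)
Lemma ext1_killed_adjoin s t J y : is_ideal J ->
  ext1_killed s (adjoin J y) -> ext1_killed t (colon J y) ->
  ext1_killed (s * t) J.
Proof.
move=> JI Ks Kt phi phil; have CI := colon_ideal y JI.
have [|c cP] := Kt (fun b => phi (b * y)).
  move=> a b1 b2 Jb1 Jb2; rewrite /GRing.scale /= mulrDl -mulrA.
  by rewrite -[a * (b1 * y)]/(a *: (b1 * y : R^o)) phil.
(* [psi] extends [t * phi] from [J] to [J + Ry] by sending [y] to [c]; the choice of [c] makes it
   independent of how [z] is written. *)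
have /choice[psi psiP] z : exists w : R, forall a b, J b -> z = a * y + b ->
    w = t * phi b + c * a.
  case: (pselect (adjoin J y z)) => [[a [b [Jb zE]]]|zJ]; last first.
    by exists 0 => a b Jb zE; case: zJ; exists a, b.
  exists (t * phi b + c * a) => a' b' Jb' zE'.
  have e : (a - a') * y = b' - b.
    have -> : b' = z - a' * y by rewrite zE' addrC addKr.
    by rewrite zE; ring.
  have Jaa : colon J y (a - a') by rewrite /colon /= e; apply: idealB.
  have := cP _ Jaa; rewrite e (@linear_onB R R^o R^o J phi JI phil b' b Jb' Jb) => h.
  apply/eqP; rewrite -subr_eq0; apply/eqP.
  rewrite (_ : _ - _ = c * (a - a') - t * (phi b' - phi b)); last by ring.
  by rewrite h subrr.
have [|d dP] := Ks psi.
  move=> e z1 z2 [a1 [b1 [Jb1 z1E]]] [a2 [b2 [Jb2 z2E]]].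
  rewrite (psiP _ _ _ Jb1 z1E) (psiP _ _ _ Jb2 z2E) /GRing.scale /=.
  have Jb : J (e * b1 + b2) by apply: idealD => //; apply: idealM.
  rewrite (psiP _ (e * a1 + a2) _ Jb); last by rewrite z1E z2E /=; ring.
  have -> : phi (e * b1 + b2) = e * phi b1 + phi b2 by exact: phil.
  ring.
exists d => j Jj; rewrite -(dP j) ?(psiP j 0 j) //; last exact: sub_adjoin.
- by rewrite mulr0 addr0 mulrA.
- by rewrite mul0r add0r.
Qed.

Hypothesis Rnoeth : noetherian R.

(** The result is an associated prime of [R/J] inside [p]: a colon ideal maximal among those
    contained in [p]. By maximality, multiplying [y] by an element outside [p] does not change
    it. *)
Lemma colon_prime J p : is_ideal J -> is_prime_ideal p -> J `<=` p ->
  exists y, is_prime_ideal (colon J y) /\ colon J y `<=` p.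
Proof.
move=> JI pp Jp.
pose F q := exists y, q = colon J y /\ q `<=` p.
have [||q [[y [-> qp]] _ qmax]] := @noetherian_maximal R Rnoeth F (colon J 1).
- by move=> _ [y [-> _]]; apply: colon_ideal.
- by exists 1; split=> // a; rewrite /colon /= mulr1 => /Jp.
have larger s : ~ p s -> colon J (s * y) = colon J y.
  move=> ps; apply: qmax.
    exists (s * y); split=> // a; rewrite /colon /= mulrA => /qp.
    by case: pp => _ _ pM /pM[].
  by move=> a; rewrite /colon /= [s * y]mulrC mulrA [_ * s]mulrC; apply: idealM.
exists y; split=> //; split; first exact: colon_ideal.
  by move=> /qp; case: pp.
(* If [colon J (a * y)] stays inside [p], it equals [colon J y] by maximality, and [b] lies in it.
   Otherwise some [s] outside [p] has [s * a * y] in [J], so [a] lies in [colon J (s * y)], which is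
   [colon J y]. *)
move=> a b; have [inp|ninp] := pselect (colon J (a * y) `<=` p).
  have e : colon J (a * y) = colon J y.
    apply: qmax; first by exists (a * y).
    by move=> c; rewrite /colon /= [a * y]mulrC mulrA [_ * a]mulrC; apply: idealM.
  move=> ab; right; rewrite -e /colon /=; move: ab; rewrite /colon /=.
  by rewrite mulrCA mulrA.
move=> _; left.
have [s /not_implyP[sc ps]] : exists s, ~ (colon J (a * y) s -> p s) by apply/existsNP.
by rewrite -(larger _ ps) /colon /=; move: sc; rewrite /colon /= mulrCA.
Qed.

(** Take [q] maximal among the ideals above [J] whose [Ext^1(R/q, R)] is killed by no element
    outside [m]. If [x * y] were in [q] with neither factor in [q], then [q + Ry] and [(q : y)]
    would be strictly larger, and [ext1_killed_adjoin] would combine their killing elements. *)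
Lemma ext1_prime J m : is_ideal J -> is_prime_ideal m ->
  ~ (exists2 s, ~ m s & ext1_killed s J) ->
  exists q, [/\ is_prime_ideal q, J `<=` q, q `<=` m &
    ~ (exists2 s, ~ m s & ext1_killed s q)].
Proof.
move=> JI mp hJ.
pose F q := is_ideal q /\ ~ (exists2 s, ~ m s & ext1_killed s q).
have [||q [[qI hq] Jq qmax]] := @noetherian_maximal R Rnoeth F J.
- by move=> q [].
- by [].
have qm : q `<=` m.
  by move=> s qs; apply: contrapT => ms; apply: hq; exists s => //;
    apply: ext1_killed_mem.
exists q; split=> //; split=> //; first by move=> /qm; case: mp.
move=> x y qxy; apply: contrapT => /not_orP[qx qy].
have [t mt Kt] : exists2 s, ~ m s & ext1_killed s (adjoin q y).
  apply: contrapT => h; apply: qy; rewrite -(qmax (adjoin q y)).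
  - exact: mem_adjoin.
  - by split=> //; apply: adjoin_ideal.
  - exact: sub_adjoin.
have [u mu Ku] : exists2 s, ~ m s & ext1_killed s (colon q y).
  apply: contrapT => h; apply: qx; rewrite -(qmax (colon q y)) //.
  - by split=> //; apply: colon_ideal.
  - exact: sub_colon.
apply: hq; exists (t * u); first exact: prime_notM.
exact: ext1_killed_adjoin Kt Ku.
Qed.

(** Let [q] be the annihilator of [a] and [H = Hom(R/q, R)], the elements killed by [q]. As [x] is a
    nonzerodivisor on [R/q], [H/xH] embeds in [Ext^1(R/(q + Rx), R)]. If [s] killed the latter, [sH]
    would lie in [xH], and Nakayama's lemma would give [t] outside [p] with [tH = 0]; but [a] is in
    [H], so [t] would be in [q]. *)
Lemma ext1_annihilator a x p : is_prime_ideal p -> is_prime_ideal (annihilator a) ->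
  annihilator a `<=` p -> p x -> ~ annihilator a x ->
  ~ (exists2 s, ~ p s & ext1_killed s (adjoin (annihilator a) x)).
Proof.
move=> pp qp qsub px qx [s ps Ks].
set q := annihilator a in qp qsub qx Ks *.
have qI := prime_ideal_ideal qp.
pose H : set R := [set h | forall t, q t -> t * h = 0].
have HI : is_ideal H.
  apply: ideal_ofP => [t qt|u v Hu Hv t qt|b u Hu t qt].
  - by rewrite mulr0.
  - by rewrite mulrDr Hu ?Hv ?addr0.
  - by rewrite mulrCA Hu ?mulr0.
have [gs HE] := Rnoeth HI.
have [||h|t pt tL] := @nakayama R^o p x s gs [set 0] pp px.
- exact: zero_ideal.
- exact: ps.
- rewrite -HE => Hh.
  (* The image of [h] under the connecting map: [r * x + t |-> r * h] on [q + Rx], well defined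
     because [q] is prime, omits [x] and kills [h]. *)
  have /choice[phi phiP] z : exists w : R, forall r t, q t -> z = r * x + t -> w = r * h.
    case: (pselect (adjoin q x z)) => [[r [t [qt zE]]]|zq]; last first.
      by exists 0 => r t qt zE; case: zq; exists r, t.
    exists (r * h) => r' t' qt' zE'.
    have : q ((r - r') * x).
      rewrite (_ : _ * _ = t' - t); first exact: idealB.
      have -> : t' = z - r' * x by rewrite zE' addrC addKr.
      by rewrite zE; ring.
    case: qp => _ _ qM /qM[qr|//].
    by apply/eqP; rewrite -subr_eq0 -mulrBl Hh.
  have [|c cP] := Ks phi.
    move=> e z1 z2 [r1 [t1 [qt1 z1E]]] [r2 [t2 [qt2 z2E]]].
    rewrite (phiP _ _ _ qt1 z1E) (phiP _ _ _ qt2 z2E) /GRing.scale /=.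
    have qt : q (e * t1 + t2) by apply: idealD => //; apply: idealM.
    rewrite (phiP _ (e * r1 + r2) _ qt); last by rewrite z1E z2E /=; ring.
    by ring.
  have q0 : q 0 by apply: ideal0.
  exists c; last first.
    rewrite /= -[s *: _]/(s * h) -[x *: _]/(x * c).
    have := cP x (mem_adjoin x qI).
    by rewrite (phiP x 1 0) ?mul1r ?addr0 // => ->; rewrite mulrC subrr.
  move=> t qt; have := cP t (sub_adjoin x qt).
  by rewrite (phiP t 0 t) // ?mul0r ?add0r // mulr0 mulrC.
- apply: pt; apply: qsub; apply: (tL a); rewrite -HE => r; exact.
Qed.

(* In dimension at most one a prime above [ann a + Rx] can only be [m]. *)
Lemma depth_le1 m : is_prime_ideal m -> krull_dim_le R 1 ->
  (forall a, (forall b, m b -> b * a = 0) -> a = 0) -> ~ ext1_killed 1 m.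
Proof.
move=> mp dimR hom0 ext0.
have [|a [qp qm]] := @colon_prime [set 0] m zero_ideal mp.
  by move=> _ ->; apply: ideal0; apply: prime_ideal_ideal.
rewrite -!annihilatorE in qp qm.
have [y my qy] : exists2 y, m y & ~ annihilator a y.
  apply: contrapT => h; have a0 : a = 0.
    by apply: hom0 => b mb; apply: contrapT => ba; apply: h; exists b.
  by case: qp => _ + _; apply; rewrite /annihilator /= a0 mulr0.
have qI := annihilator_ideal a.
have := ext1_prime (adjoin_ideal y qI) mp (ext1_annihilator mp qp qm my qy).
move=> [P [Pp qyP Pm hP]].
have PE : P = m.
  apply: contrapT => Pne.
  (* The default value of [nth] supplies the third prime [m] of the chain. *)
  pose c (i : 'I_3) := nth (PrimeIdeal mp) [:: PrimeIdeal qp; PrimeIdeal Pp] i.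
  suff : (2 <= 1)%N by [].
  apply: (dimR 2%N c); case=> [[|[|[|]]]]// ? [[|[|[|]]]]// ? _; split=> //=.
  - by apply: subset_trans qyP; apply: sub_adjoin.
  - by move=> /(_ y (qyP _ (mem_adjoin y qI))).
  - by move=> /(_ _ my).
  - by move=> mP; apply: Pne; apply/seteqP.
by apply: hP; rewrite PE; exists 1 => //; case: mp.
Qed.

End IdealTheory.

(** * Ext through exact matrices *)

Section ExactMatrices.
Variable R : comPzRingType.

Definition row_exact a b c (M : 'M[R]_(a, b)) (N : 'M[R]_(b, c)) : Prop :=
  M *m N = 0 /\ forall v : 'rV_b, v *m N = 0 -> exists u, v = u *m M.

Definition col_exact a b c (M : 'M[R]_(a, b)) (N : 'M[R]_(b, c)) : Prop :=
  forall x : 'cV_b, M *m x = 0 -> exists y, x = N *m y.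

Fixpoint exact_chain k b c (N : 'M[R]_(b, c)) : Prop :=
  if k is k'.+1 then
    exists d (P : 'M[R]_(c, d)), row_exact N P /\ exact_chain k' P
  else True.

(* Since [N] is followed by [k] exact matrices, the cohomology of the dual at
   [N] is [Ext^(k+1)(C, R)] with [C] the cokernel of the last matrix. *)
Definition ext_vanish k : Prop :=
  forall a b c (M : 'M[R]_(a, b)) (N : 'M[R]_(b, c)),
    row_exact M N -> exact_chain k N -> col_exact M N.

Lemma row_exact_mx a b c (M : 'M[R]_(a, b)) (N : 'M[R]_(b, c)) d
    (V : 'M_(d, b)) :
  row_exact M N -> V *m N = 0 -> exists U, V = U *m M.
Proof.
move=> [_ MN] VN.
have /choice[u uP] i : exists u, row i V = u *m M.
  by apply: MN; rewrite -row_mul VN row0.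
exists (\matrix_i u i); apply/row_matrixP => i.
by rewrite row_mul rowK -uP.
Qed.

Lemma col_exact_mx a b c (M : 'M[R]_(a, b)) (N : 'M[R]_(b, c)) d
    (X : 'M_(b, d)) :
  col_exact M N -> M *m X = 0 -> exists Y, X = N *m Y.
Proof.
move=> MN MX.
have /choice[y yP] j : exists y, col j X = N *m y.
  by apply: MN; rewrite colE mulmxA MX mul0mx.
exists (\matrix_(i, j) y j i ord0); apply/matrixP => i j.
have /matrixP/(_ i ord0) := yP j; rewrite !mxE => ->.
by apply: eq_bigr => k _; rewrite !mxE.
Qed.

Lemma row_exact_tr a b c (M : 'M[R]_(a, b)) (N : 'M[R]_(b, c)) :
  M *m N = 0 -> col_exact M N -> row_exact N^T M^T.
Proof.
move=> MN cMN; split; first by rewrite -trmx_mul MN trmx0.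
move=> v vM; have [|y yE] := cMN v^T.
  by apply: trmx_inj; rewrite trmx_mul trmxK vM trmx0.
by exists y^T; rewrite -trmx_mul -yE trmxK.
Qed.

Lemma col_exact_trP a b c (M : 'M[R]_(a, b)) (N : 'M[R]_(b, c)) (v : 'rV_b) :
  col_exact N^T M^T -> v *m N = 0 -> exists u, v = u *m M.
Proof.
move=> h vN; have [|y yE] := h v^T; first by rewrite -trmx_mul vN trmx0.
by exists y^T; apply: trmx_inj; rewrite trmx_mul trmxK.
Qed.

Lemma exact_chainS k b c (N : 'M[R]_(b, c)) :
  exact_chain k.+1 N -> exact_chain k N.
Proof.
elim: k b c N => // k IHk b c N [d [P [NP PC]]].
by exists d, P; split=> //; apply: IHk.
Qed.

Lemma exact_chain_cons k a b c (M : 'M[R]_(a, b)) (N : 'M[R]_(b, c)) :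
  row_exact M N -> exact_chain k N -> exact_chain k M.
Proof.
case: k => // k MN NC; exists c, N; split=> //; exact: exact_chainS.
Qed.

Lemma ext_vanishS k : ext_vanish k -> ext_vanish k.+1.
Proof. by move=> Ek a b c M N MN /exact_chainS; apply: Ek. Qed.

Hypothesis Rnoeth : noetherian R.

Lemma left_kernel b c (N : 'M[R]_(b, c)) :
  exists a (M : 'M[R]_(a, b)), row_exact M N.
Proof.
have [|s sE] := noetherian_rV Rnoeth (N := [set v : 'rV_b | v *m N = 0]).
  split=> [|a x y /= xN yN]; first by rewrite /= mul0mx.
  by rewrite mulmxDl -scalemxAl xN yN scaler0 addr0.
pose M := \matrix_(i < size s) s`_i; exists (size s), M; split.
  apply/row_matrixP => i; rewrite row_mul rowK row0.
  have : generated s s`_i by apply/mem_generated/mem_nth.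
  by rewrite -sE.
move=> v vN; have : generated s v by rewrite -sE.
move=> [c' ->]; exists (\row_i c' i); rewrite mulmx_sum_row.
by apply: eq_bigr => i _; rewrite mxE rowK.
Qed.

Lemma right_kernel a b (M : 'M[R]_(a, b)) :
  exists c (N : 'M[R]_(b, c)), M *m N = 0 /\ col_exact M N.
Proof.
have [c [N [NM hN]]] := left_kernel M^T.
exists c, N^T; split; first by apply: trmx_inj; rewrite trmx_mul trmxK NM trmx0.
move=> x Mx; have [|u uE] := hN x^T; first by rewrite -trmx_mul Mx trmx0.
by exists u^T; apply: trmx_inj; rewrite trmx_mul !trmxK.
Qed.

(** A free resolution continues [M] to the left without end, and [ext_vanish] makes each of its
    steps exact after transposition; so the chain starting at [M^T] has any length [m]. *)
Lemma exact_chain_tr k m a b (M : 'M[R]_(a, b)) : ext_vanish k ->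
  exact_chain k M -> exact_chain m M^T.
Proof.
move=> Ek; elim: m a b M => // m IHm a b M MC.
have [d [P PM]] := left_kernel M.
exists d, P^T; split.
  by apply: row_exact_tr; [case: PM|apply: Ek].
exact: IHm (exact_chain_cons PM MC).
Qed.

End ExactMatrices.

(** * Descent of Ext vanishing over a local ring of dimension at most one *)

Section Grade.
Variables (R : comPzRingType) (m : set R).
Hypotheses (Rnoeth : noetherian R) (mp : is_prime_ideal m).
Hypotheses (mlocal : forall a, ~ m a -> exists b, b * a = 1).
Hypothesis dimR : krull_dim_le R 1.

Lemma proper_sub_local (J : set R) : is_ideal J -> ~ J 1 -> J `<=` m.
Proof.
move=> JI J1 a Ja; apply: contrapT => /mlocal[b ba].
by apply: J1; rewrite -ba; apply: idealM.
Qed.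

(* The hypotheses say that the cokernel of [Q] has no nonzero [Hom] nor [Ext^1]
   into [R]; a nonzero cokernel maps onto [R/m] and [R/m] inherits this. *)
Lemma grade_le1 g h (Q : 'M[R]_(g, h)) :
  (forall u : 'rV_g, u *m Q = 0 -> u = 0) ->
  (forall t : 'rV_h, (forall y : 'cV_h, Q *m y = 0 -> t *m y = 0) ->
     exists u, t = u *m Q) ->
  forall x : 'cV_g, exists y, x = Q *m y.
Proof.
move=> homQ extQ.
(* A filtration from the image of [Q] at [i = 0] to the whole module at [i = g]. Where it first
   becomes everything, the quotient by the step before is nonzero and cyclic, generated by a basis
   vector. *)
pose X (i : nat) : set 'cV[R]_g :=
  [set x | exists y : 'cV_h, forall j : 'I_g, (i <= j)%N -> x j ord0 = (Q *m y) j ord0].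
have XS i : is_submodule (X i).
  split=> [|a x1 x2 [y1 h1] [y2 h2]].
    by exists 0 => j _; rewrite mulmx0.
  exists (a *: y1 + y2) => j ij.
  by rewrite mulmxDr -scalemxAr !mxE h1 ?h2 // !mxE.
have X0 x : X 0%N x -> exists y, x = Q *m y.
  by move=> [y xy]; exists y; apply/colP => j; apply: xy.
apply: contrapT => nQ.
have [i [ltig Xi XSi]] : exists i, [/\ (i < g)%N, ~ (forall x, X i x) & forall x, X i.+1 x].
  have Xg : forall x, X g x by move=> x; exists 0 => j; rewrite leqNgt ltn_ord.
  have {}nQ : ~ forall x, X 0%N x by move=> h0; apply: nQ => x; apply: X0.
  have : forall k, (k <= g)%N -> (forall x, X k x) ->
      exists i, [/\ (i < g)%N, ~ (forall x, X i x) & forall x, X i.+1 x].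
    elim=> [|k IHk] kg Xk; first by [].
    have [/IHk|nXk] := pselect (forall x, X k x); first by apply; apply: ltnW.
    by exists k.
  by apply; first exact: leqnn.
pose i' : 'I_g := Ordinal ltig; pose e (j : 'I_g) : 'cV[R]_g := delta_mx j ord0.
have projX x : exists a, X i (x - a *: e i').
  have [y yP] := XSi x; exists (x i' ord0 - (Q *m y) i' ord0), y => j.
  rewrite leq_eqVlt => /orP[/eqP ij|ij].
    have -> : j = i' by apply: val_inj.
    by rewrite !mxE !eqxx mulr1 subKr.
  rewrite !mxE -val_eqE /= (gtn_eqF ij) mulr0 subr0 yP //.
  by rewrite mxE.
pose J : set R := [set a | X i (a *: e i')].
have JI : is_ideal J.
  apply: ideal_ofP => [|a b Ja Jb|a b Jb]; rewrite /J /=.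
  - by rewrite scale0r; apply: submodule0.
  - by rewrite scalerDl; apply: submoduleD.
  - by rewrite -scalerA; apply: submoduleZ.
have Jm : J `<=` m.
  apply: proper_sub_local => //; rewrite /J /= scale1r => Xe; apply: Xi => x.
  have [a Xa] := projX x; rewrite -[x](subrK (a *: e i')).
  by apply: submoduleD => //; apply: submoduleZ.
have /choice[al0 al0P] j : exists a, X i (e j - a *: e i') by apply: projX.
(* The row [al] induces the map from the cokernel of [Q] onto the quotient by [X i], which is [R/J].
   Its entry at [i'] is set to 1 so that identities between multiples of [al] can be read off
   there. *)
pose al : 'rV[R]_g := \row_j (if j == i' then 1 else al0 j).
have ali : al ord0 i' = 1 by rewrite mxE eqxx.
have alP j : X i (e j - al ord0 j *: e i').
  by rewrite mxE; case: eqP => // ->; rewrite scale1r subrr; apply: submodule0.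
have alJ x : X i x -> J ((al *m x) ord0 ord0).
  move=> Xx; rewrite /J /= mxE.
  have xE : x = \sum_j x j ord0 *: e j.
    by rewrite [LHS]matrix_sum_delta; apply: eq_bigr => j _; rewrite big_ord1.
  have -> : (\sum_j al ord0 j * x j ord0) *: e i' =
      x - \sum_j x j ord0 *: (e j - al ord0 j *: e i').
    rewrite {2}xE -sumrB scaler_suml; apply: eq_bigr => j _.
    by rewrite scalerBr subKr scalerA mulrC.
  by apply: submoduleB => //; apply: submodule_sum => // j; apply: submoduleZ.
have alQ (y : 'cV_h) : m ((al *m Q *m y) ord0 ord0).
  by rewrite -mulmxA; apply: Jm; apply: alJ; exists y.
have mI := prime_ideal_ideal mp.
have alQl l : m ((al *m Q) ord0 l).
  have := alQ (delta_mx l ord0).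
  by rewrite -[_ *m delta_mx _ _]colE mxE.
apply: (depth_le1 Rnoeth mp dimR).
  move=> z zm; have : z *: al = 0.
    apply: homQ; apply/rowP => l; rewrite -scalemxAl !mxE mulrC.
    by have := zm _ (alQl l); rewrite mxE.
  by move/rowP/(_ i'); rewrite [LHS]mxE ali mulr1 mxE.
move=> phi phil.
(* Pulling [phi] back along [al *m Q] gives a row vanishing on [ker Q], hence of the form [u *m Q].
   For [b] in [m] the rows [phi b *: al] and [b *: u] have the same product with [Q], so they agree,
   and the entry at [i'] exhibits [phi] as a multiplication. *)
have [|u uE] := extQ (\row_l phi ((al *m Q) ord0 l)).
  move=> y Qy; apply/rowP => k; rewrite (ord1 k) mxE [RHS]mxE.
  transitivity (\sum_l phi (y l ord0 * (al *m Q) ord0 l)).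
    by apply: eq_bigr => l _; rewrite mxE (idealZ _ mI phil) // mulrC.
  rewrite -(@linear_on_sum R R^o R^o m phi mI phil) => [|l]; last exact: idealM.
  transitivity (phi ((al *m Q *m y) ord0 ord0)).
    by congr phi; rewrite mxE; apply: eq_bigr => l _; rewrite mulrC.
  rewrite -mulmxA Qy mulmx0 mxE.
  exact: (@linear_on0 R R^o R^o m phi mI phil).
exists (u ord0 i') => b mb; rewrite mul1r.
have : phi b *: al - b *: u = 0.
  apply: homQ; rewrite mulmxBl -!scalemxAl -uE; apply/rowP => l.
  rewrite [LHS]mxE [in X in _ + X]mxE [X in X + _]mxE [in X in _ + X]mxE [in X in _ + X]mxE.
  rewrite [RHS]mxE -(idealZ b mI phil) // [b * _]mulrC (idealZ _ mI phil) //.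
  by rewrite mulrC subrr.
move/rowP/(_ i'); rewrite [LHS]mxE [X in X + _]mxE ali mulr1 [X in _ + X]mxE [in X in _ + X]mxE.
by rewrite [RHS]mxE => /eqP; rewrite subr_eq0 => /eqP ->; rewrite mulrC.
Qed.

(* [X], the cohomology of the dual at [N], is presented by [Q] and [H] below;
   exactness of the transposed chain and of the original one gives
   [Hom(X, R) = Ext^1(X, R) = 0]. *)
Lemma ext_vanish_pred k : ext_vanish R k.+2 -> ext_vanish R k.+1.
Proof.
move=> Ek a b c M N MN [d [P [NP PC]]] x Mx.
have MC : exact_chain k.+2 M.
  by exists c, N; split=> //; exists d, P.
(* The dual complex is exact to any length, so the hypothesis applies to it in turn, and transposing
   back keeps it exact. *)
have dualC n : exact_chain n M^T by exact: exact_chain_tr Ek MC.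
have [g [G [MG hG]]] := right_kernel Rnoeth M.
have [h [H [GH hH]]] := right_kernel Rnoeth G.
have [l [L [HL hL]]] := right_kernel Rnoeth H.
have GM := row_exact_tr MG hG; have HG := row_exact_tr GH hH.
have LH := row_exact_tr HL hL.
have GC n : exact_chain n G^T by exact: exact_chain_cons GM (dualC n).
have HC n : exact_chain n H^T by exact: exact_chain_cons HG (GC n).
have cGM : col_exact G^T M^T := Ek _ _ _ _ _ GM (dualC _).
have cHG : col_exact H^T G^T := Ek _ _ _ _ _ HG (GC _).
have cLH : col_exact L^T H^T := Ek _ _ _ _ _ LH (HC _).
(* The columns of [G] generate [ker M] and those of [H] their relations; writing [N = G *m Q]
   presents [ker M / im N] as the cokernel of [row_mx Q H]. *)
have [Q NE] := col_exact_mx hG (proj1 MN).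
have homX (u : 'rV_g) : u *m row_mx Q H = 0 -> u = 0.
  rewrite mul_mx_row -(row_mx0 R 1 c h) => /eq_row_mx[uQ uH].
  have [v uE] := col_exact_trP cHG uH.
  have [|w vE] := proj2 MN v; first by rewrite NE mulmxA -uE.
  by rewrite uE vE -mulmxA MG mulmx0.
(* Vanishing on the columns of [L] gives [r = w *m H]. The columns of [P] extend to relations
   between [Q] and [H], which gives [s - w *m Q = v *m N]. As [G *m H = 0], the row [w + v *m G]
   serves both blocks. *)
have extX (t : 'rV_(c + h)) :
    (forall y : 'cV_(c + h), row_mx Q H *m y = 0 -> t *m y = 0) ->
    exists u, t = u *m row_mx Q H.
  rewrite -[t]hsubmxK; set s := lsubmx t; set r := rsubmx t => tP.
  have {}tP (y : 'cV_c) (z : 'cV_h) : Q *m y + H *m z = 0 -> s *m y + r *m z = 0.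
    by move=> yz; rewrite -mul_row_col; apply: tP; rewrite mul_row_col.
  have [|w rE] := @col_exact_trP _ _ _ _ H L r cLH.
    apply/matrixP => i j; rewrite [RHS]mxE.
    have : s *m 0 + r *m col j L = 0.
      by apply: tP; rewrite mulmx0 add0r colE mulmxA HL mul0mx.
    rewrite mulmx0 add0r colE mulmxA -colE => /colP/(_ i).
    by rewrite [LHS]mxE [RHS]mxE.
  have [|v sE] := proj2 NP (s - w *m Q).
    apply/rowP => j; have [|y Py] := hH (Q *m col j P).
      by rewrite mulmxA -NE colE mulmxA (proj1 NP) mul0mx.
    have := tP (col j P) (- y); rewrite mulmxN Py subrr => /(_ erefl).
    rewrite rE mulmxN -mulmxA -Py mulmxA -mulmxBl colE mulmxA -colE.
    by move/colP/(_ ord0); rewrite [LHS]mxE [RHS]mxE => ->; rewrite mxE.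
  exists (w + v *m G); rewrite mul_mx_row !mulmxDl -!mulmxA -NE GH mulmx0 addr0.
  by rewrite -sE addrC subrK -rE.
have [y xE] := hG x Mx.
have [z yE] := grade_le1 homX extX y.
exists (usubmx z).
rewrite xE yE -[z in LHS]vsubmxK mul_row_col mulmxDr !mulmxA GH mul0mx addr0.
by rewrite NE.
Qed.

Lemma ext_vanish_descent k : ext_vanish R k -> ext_vanish R 1.
Proof.
case: k => [|k]; first exact: ext_vanishS.
by elim: k => // k IHk /ext_vanish_pred.
Qed.

End Grade.

(** * Vanishing of Ext^2 bounds the Krull dimension *)

Section KrullDimension.
Variable R : comPzRingType.
Hypotheses (Rnoeth : noetherian R) (R1 : ext_vanish R 1).

(** Given [p0 < p1 < p2], an associated prime of [R] inside [p0] yields a prime [q] inside [p1] with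
    [Ext^1(R/q, R)] killed by no element outside [p1]. For [y] in [p2] outside [p1], multiplication
    by [y] is surjective on this module, so Nakayama's lemma at [p2] kills it by an element outside
    [p2], a contradiction. *)
Lemma krull_dim_le1 : krull_dim_le R 1.
Proof.
move=> k c cP; rewrite leqNgt; apply/negP => k1.
have [p0 [p1 [p2 [pp0 pp1 pp2 [p01 n01] [p12 n12]]]]] :
    exists p0 p1 p2 : set R, [/\ is_prime_ideal p0, is_prime_ideal p1,
      is_prime_ideal p2, p0 `<` p1 & p1 `<` p2].
  exists (c ord0), (c (inord 1)), (c (inord 2)).
  by split; try exact: prime_idealP; apply: cP; rewrite /= !inordK // ltnW.
have [|a [qp qp0]] := colon_prime Rnoeth (zero_ideal R) pp0.
  by move=> _ ->; apply: ideal0; apply: prime_ideal_ideal.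
rewrite -!annihilatorE in qp qp0.
have [x p1x p0x] : exists2 x, p1 x & ~ p0 x.
  by apply: contrapT => h; apply: n01 => x p1x; apply: contrapT => p0x;
    apply: h; exists x.
have [y p2y p1y] : exists2 y, p2 y & ~ p1 y.
  by apply: contrapT => h; apply: n12 => y p2y; apply: contrapT => p1y;
    apply: h; exists y.
have [q [pq _ qp1 nq]] :=
  ext1_prime Rnoeth (adjoin_ideal x (annihilator_ideal a)) pp1
  (ext1_annihilator Rnoeth pp1 qp (subset_trans qp0 p01) p1x (fun h => p0x (qp0 _ h))).
have qI := prime_ideal_ideal pq; have [s sE] := Rnoeth qI.
pose n := size s; pose gen : 'cV[R]_n := \col_i s`_i.
have qgen (b : 'rV_n) : q ((b *m gen) ord0 ord0).
  rewrite sE; exists (fun i => b ord0 i); rewrite mxE.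
  by apply: eq_bigr => i _; rewrite !mxE.
have genq t : q t -> exists b : 'rV_n, t = (b *m gen) ord0 ord0.
  rewrite sE => -[b ->]; exists (\row_i b i); rewrite mxE.
  by apply: eq_bigr => i _; rewrite !mxE.
(* [Hom(q, R)] and its submodule [R] in coordinates. *)
pose Hom : set 'rV[R]_n :=
  [set v | exists2 phi, hom_on q phi & v = \row_i phi s`_i].
have sq i : (i < n)%N -> q s`_i.
  by move=> ?; rewrite sE; apply/mem_generated/mem_nth.
pose L : set 'rV[R]_n := [set v | exists d, v = d *: gen^T].
have LS : is_submodule L.
  split=> [|d _ _ [e ->] [f ->]]; first by exists 0; rewrite scale0r.
  by exists (d * e + f); rewrite scalerDl scalerA.
have HomS : is_submodule Hom.
  split=> [|d _ _ [f fl ->] [g gl ->]].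
    exists (fun=> 0); first by move=> d u v _ _; rewrite scaler0 addr0.
    by apply/rowP => i; rewrite !mxE.
  exists (fun x => d * f x + g x); last by apply/rowP => i; rewrite !mxE.
  move=> e u v qu qv; rewrite fl // gl // /GRing.scale /=; ring.
have [gs HomE] := noetherian_rV Rnoeth HomS.
(* Vanishing of [Ext^2(R/(q + Ry), R)] makes [y] surjective on
   [Ext^1(R/q, R)]. *)
have [|v|t pt tL] := @nakayama R _ p2 y 1 gs L pp2 p2y LS.
- by case: pp2.
- rewrite -HomE => -[phi phil ->].
  (* [M0] lists generators of [q + Ry] and [M1] their syzygies. As [y] is not in [q], the first
     entry of a syzygy lies in [q]; applying [phi] to it gives a cocycle [c1], which is the
     coboundary of some [w]. *)
  pose M0 : 'M[R]_(1 + n, 1) := col_mx y%:M gen.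
  have [a1 [M1 M10]] := left_kernel Rnoeth M0.
  have [a2 [M2 M21]] := left_kernel Rnoeth M1.
  have qM1 (u : 'rV_(1 + n)) : u *m M0 = 0 -> q (u ord0 ord0).
    rewrite -{1}[u]hsubmxK mul_row_col => /eqP;
      rewrite addr_eq0 => /eqP/matrixP/(_ ord0 ord0).
    rewrite mxE big_ord1 [RHS]mxE [y%:M _ _]mxE eqxx mulr1n => uy.
    have : q (lsubmx u ord0 ord0 * y).
      by rewrite uy; apply: (@submoduleN R R^o).
    case: pq => _ _ qM /qM[|/qp1//].
    by rewrite !mxE; congr (q (u _ _)); apply: val_inj.
  pose c1 : 'cV_a1 := \col_l phi (M1 l ord0).
  have qM1l l : q (M1 l ord0).
    have := qM1 (row l M1); rewrite mxE; apply.
    by rewrite -row_mul (proj1 M10) row0.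
  have c1P (v' : 'rV_a1) : (v' *m c1) ord0 ord0 = phi ((v' *m M1) ord0 ord0).
    rewrite !mxE (@linear_on_sum R R^o R^o q phi qI phil) => [|l];
      last exact: idealM.
    by apply: eq_bigr => l _; rewrite mxE (idealZ _ qI phil).
  have [|w wE] := R1 M21 (ex_intro _ _ (ex_intro _ M0 (conj M10 I))) (x := c1).
    apply/row_matrixP => k'; rewrite row_mul row0; apply/rowP => j;
      rewrite (ord1 j) c1P.
    rewrite -row_mul (proj1 M21) row0 !mxE.
    exact: (@linear_on0 R R^o R^o q phi qI phil).
  have phiE (u : 'rV_(1 + n)) : u *m M0 = 0 -> phi (u ord0 ord0) = (u *m w) ord0 ord0.
    by move=> /(proj2 M10)[v' ->]; rewrite -mulmxA -wE c1P.
  have u0E (r : R) (b : 'rV_n) : (row_mx r%:M b : 'rV_(1 + n)) ord0 ord0 = r.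
    have -> : ord0 = lshift n ord0 :> 'I_(1 + n) by apply: val_inj.
    by rewrite row_mxEl mxE eqxx mulr1n.
  pose w1 := usubmx w ord0 ord0; pose w2 := dsubmx w.
  have uwE (r : R) (b : 'rV_n) :
      (row_mx r%:M b *m w) ord0 ord0 = r * w1 + (b *m w2) ord0 ord0.
    rewrite -[w in LHS]vsubmxK mul_row_col mxE; congr (_ + _).
    by rewrite mul_scalar_mx mxE.
  (* The block [w2] defines a functional on [q]: two expressions of [t] differ by a syzygy with
     first entry zero, on which [w] takes the value [phi 0]. *)
  have /choice[psi psiP] t : exists z : R, forall b : 'rV_n,
      t = (b *m gen) ord0 ord0 -> z = (b *m w2) ord0 ord0.
    have [[b tE]|nt] := pselect (exists b : 'rV_n, t = (b *m gen) ord0 ord0);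
      last first.
      by exists 0 => b tE; case: nt; exists b.
    exists ((b *m w2) ord0 ord0) => b' tE'.
    have := uwE 0 (b - b'); rewrite -phiE ?u0E; last first.
      rewrite mul_row_col (_ : 0%:M = 0); last by apply/matrixP => i j;
        rewrite !mxE mul0rn.
      rewrite mul0mx add0r mulmxBl; apply/rowP => i.
      by rewrite (ord1 i) mxE [X in _ + X]mxE -tE -tE' subrr mxE.
    rewrite (@linear_on0 R R^o R^o q phi qI phil) mul0r add0r mulmxBl mxE [X in _ + X]mxE.
    by move/esym/eqP; rewrite subr_eq0 => /eqP.
  have psil : hom_on q psi.
    move=> e t1 t2 /genq[b1 t1E] /genq[b2 t2E].
    rewrite (psiP _ _ t1E) (psiP _ _ t2E) (psiP _ (e *: b1 + b2)).
      by rewrite mulmxDl -scalemxAl !mxE.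
    by rewrite t1E t2E mulmxDl -scalemxAl !mxE.
  (* If [r = b *m gen], the row with blocks [r] and [- (y *: b)] is a syzygy. So [phi] is [- y]
     times [psi] up to a multiplication by [w1]. *)
  have phipsi r : q r -> phi r = r * w1 - y * psi r.
    move=> /genq[b rE].
    rewrite -[r in LHS](u0E r (- (y *: b))) phiE ?uwE.
      by rewrite (psiP _ _ rE) mulNmx -scalemxAl !mxE.
    rewrite mul_row_col mul_scalar_mx mulNmx -scalemxAl; apply/rowP => i.
    by rewrite (ord1 i) !mxE eqxx mulr1n [in X in _ - X]mulrC rE mxE mulrC subrr.
  exists (- (\row_i psi s`_i)).
    by apply: submoduleN => //; exists psi.
  exists w1; apply/rowP => i; rewrite !mxE mul1r mulrN opprK phipsi; last exact: sq.
  by rewrite subrK mulrC.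
apply: nq; exists t; first by move/p12.
move=> phi phil; have [|d dE] := tL (\row_i phi s`_i).
  by rewrite -HomE; exists phi.
exists d => j /genq[b ->].
rewrite mxE (@linear_on_sum R R^o R^o q phi qI phil) => [|i]; last first.
  by rewrite mxE; apply: idealM => //; apply: sq.
rewrite !mulr_sumr; apply: eq_bigr => i _; rewrite mxE (idealZ _ qI phil);
  last exact: sq.
have /rowP/(_ i) := dE; rewrite !mxE => e.
by rewrite mulrCA e mulrCA.
Qed.

End KrullDimension.

(** * Quotient modules and injective modules *)

Definition linear_map (R : pzRingType) (M N : lmodType R) (f : M -> N)
    (fl : linear f) : {linear M -> N} :=
  HB.pack f (GRing.isLinear.Build R M N *:%R f fl).

Lemma linear_inj (R : pzRingType) (M N : lmodType R) (f : {linear M -> N}) :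
  (forall x, f x = 0 -> x = 0) -> injective f.
Proof.
move=> h x y fxy; apply/eqP; rewrite -subr_eq0; apply/eqP/h.
by rewrite linearB fxy subrr.
Qed.

Record submodule (R : pzRingType) (M : lmodType R) := Submodule {
  submodule_set :> set M;
  submoduleP : is_submodule submodule_set }.

Section QuotientModule.
Local Open Scope quotient_scope.
Variables (R : pzRingType) (M : lmodType R) (N : submodule M).
Implicit Types x y z : M.
Let NS := submoduleP N.

Definition quot_equiv x y : bool := `[< (N : set M) (x - y) >].

Lemma quot_equiv_refl : reflexive quot_equiv.
Proof. by move=> x; apply/asboolP; rewrite subrr; apply: submodule0. Qed.

Lemma quot_equiv_sym : symmetric quot_equiv.
Proof.
by move=> x y; apply/asboolP/asboolP => h; rewrite -opprB; apply: submoduleN.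
Qed.

Lemma quot_equiv_trans : transitive quot_equiv.
Proof.
move=> y x z /asboolP xy /asboolP yz; apply/asboolP.
by rewrite -[x](subrK y) -addrA; apply: submoduleD.
Qed.

Canonical quot_equiv_equiv :=
  EquivRel quot_equiv quot_equiv_refl quot_equiv_sym quot_equiv_trans.

Definition quotient_module : Type := {eq_quot quot_equiv}.
HB.instance Definition _ : EqQuotient _ quot_equiv quotient_module :=
  EqQuotient.on quotient_module.
HB.instance Definition _ := Choice.on quotient_module.

Lemma quot_eqP x y : reflect ((N : set M) (x - y)) (x == y %[mod quotient_module]).
Proof. by rewrite eqmodE; apply: asboolP. Qed.

Lemma quot_repr x : (N : set M) (repr (\pi_quotient_module x) - x).
Proof. by apply/quot_eqP; rewrite reprK. Qed.

Lemma quot_ind (P : quotient_module -> Prop) :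
  (forall x, P (\pi_quotient_module x)) -> forall u, P u.
Proof. by move=> h u; rewrite -[u]reprK. Qed.

Definition quot_zero : quotient_module := \pi_quotient_module 0.
Definition quot_opp (u : quotient_module) : quotient_module :=
  \pi_quotient_module (- repr u).
Definition quot_add (u v : quotient_module) : quotient_module :=
  \pi_quotient_module (repr u + repr v).
Definition quot_scale (a : R) (u : quotient_module) : quotient_module :=
  \pi_quotient_module (a *: repr u).

Lemma quot_addE x y : quot_add (\pi_quotient_module x) (\pi y) = \pi_quotient_module (x + y).
Proof.
by apply/eqP/quot_eqP; rewrite opprD addrACA; apply: submoduleD => //;
  apply: quot_repr.
Qed.

Lemma quot_oppE x : quot_opp (\pi_quotient_module x) = \pi_quotient_module (- x).
Proof. by apply/eqP/quot_eqP; rewrite -opprD; apply: submoduleN => //;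
  apply: quot_repr. Qed.

Lemma quot_scaleE a x : quot_scale a (\pi_quotient_module x) = \pi_quotient_module (a *: x).
Proof. by apply/eqP/quot_eqP; rewrite -scalerBr; apply: submoduleZ => //;
  apply: quot_repr. Qed.

Lemma quot_addA : associative quot_add.
Proof.
elim/quot_ind=> x; elim/quot_ind=> y; elim/quot_ind=> z.
by rewrite (quot_addE y) (quot_addE x y) !quot_addE addrA.
Qed.

Lemma quot_addC : commutative quot_add.
Proof. by elim/quot_ind=> x; elim/quot_ind=> y; rewrite !quot_addE addrC. Qed.

Lemma quot_add0 : left_id quot_zero quot_add.
Proof. by elim/quot_ind=> x; rewrite quot_addE add0r. Qed.

Lemma quot_addN : left_inverse quot_zero quot_opp quot_add.
Proof. by elim/quot_ind=> x; rewrite quot_oppE quot_addE addNr. Qed.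

HB.instance Definition _ := GRing.isZmodule.Build quotient_module
  quot_addA quot_addC quot_add0 quot_addN.

Lemma quot_scaleA a b u : quot_scale a (quot_scale b u) = quot_scale (a * b) u.
Proof. by elim/quot_ind: u => x; rewrite (quot_scaleE b) !quot_scaleE scalerA. Qed.

Lemma quot_scale1 : left_id 1 quot_scale.
Proof. by elim/quot_ind=> x; rewrite quot_scaleE scale1r. Qed.

Lemma quot_scaleDr : right_distributive quot_scale +%R.
Proof.
move=> a; elim/quot_ind=> x; elim/quot_ind=> y.
rewrite -![_ + _]/(quot_add _ _) (quot_addE x) (quot_scaleE a x) (quot_scaleE a y).
by rewrite quot_addE quot_scaleE scalerDr.
Qed.

Lemma quot_scaleDl u : {morph quot_scale^~ u : a b / a + b}.
Proof.
elim/quot_ind: u => x a b.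
rewrite -![RHS]/(quot_add _ _) (quot_scaleE a x) (quot_scaleE b x).
by rewrite quot_addE quot_scaleE scalerDl.
Qed.

HB.instance Definition _ := GRing.Zmodule_isLmodule.Build R quotient_module
  quot_scaleA quot_scale1 quot_scaleDr quot_scaleDl.

Definition quot_pi x : quotient_module := \pi_quotient_module x.

Lemma quot_pi_linear : linear quot_pi.
Proof.
move=> a x y; rewrite -[RHS]/(quot_add (quot_scale _ _) _).
by rewrite quot_scaleE quot_addE.
Qed.

HB.instance Definition _ := GRing.isLinear.Build R M quotient_module _ quot_pi
  quot_pi_linear.

Lemma quot_pi_surj u : exists x, u = quot_pi x.
Proof. by elim/quot_ind: u => x; exists x. Qed.

Lemma quot_pi_eq0 x : quot_pi x = 0 <-> (N : set M) x.
Proof.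
split=> [/eqP/quot_eqP|Nx]; first by rewrite subr0.
by apply/eqP/quot_eqP; rewrite subr0.
Qed.

Lemma quot_lift (E : lmodType R) (f : {linear M -> E}) :
  (forall x, (N : set M) x -> f x = 0) ->
  exists g : {linear quotient_module -> E}, forall x, g (quot_pi x) = f x.
Proof.
move=> fN; pose g0 (u : quotient_module) := f (repr u).
have g0E x : g0 (quot_pi x) = f x.
  by apply/eqP; rewrite -subr_eq0 -linearB fN //; apply: quot_repr.
have gl : linear g0.
  move=> a u v; have [x ->] := quot_pi_surj u; have [y ->] := quot_pi_surj v.
  by rewrite -linearP !g0E linearP.
by exists (linear_map gl).
Qed.

End QuotientModule.

Lemma range_submodule (R : pzRingType) (M N : lmodType R) (f : {linear M -> N}) :
  is_submodule (range f).
Proof.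
split=> [|a _ _ [x _ <-] [y _ <-]]; first by exists 0; rewrite ?linear0.
by exists (a *: x + y); rewrite ?linearP.
Qed.

(** * Baer's criterion and the divisible group Q/Z *)

Section Baer.
Variables (R : pzRingType) (E : lmodType R).

Definition baer : Prop :=
  forall (J : set R^o) (f : R^o -> E), is_submodule J -> linear_on J f ->
    exists e, forall a : R, J a -> f a = a *: e.

Hypothesis Ebaer : baer.

(** A maximal graph is defined everywhere: for given [x], the ideal of the [a] with [a *: x] in its
    domain maps to [E] by [a |-> a *: e] for some [e], so [(x, e)] can be adjoined. *)
Lemma baer_extend (M : lmodType R) (N : set M) (f : M -> E) :
  is_submodule N -> linear_on N f ->
  exists h : {linear M -> E}, forall x, N x -> h x = f x.
Proof.
move=> NS fl.
(* Graphs of partial linear maps extending [f]. *)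
pose P (G : set (M * E)) := G = set0 \/
  [/\ forall a u v, G u -> G v -> G (a *: u + v),
      forall e, G (0, e) -> e = 0 & forall x, N x -> G (x, f x)].
have P0 : P [set u | N u.1 /\ u.2 = f u.1].
  right; split=> [a [x e] [y e'] [/= Nx ->] [/= Ny ->]|e [_ /= ->]|x Nx].
  - by split; [apply: NS.2|rewrite /= fl].
  - exact: linear_on0 NS fl.
  - by [].
have [C CP Ctot|G [PG Gmax]] := @Zorn_bigcup _ P.
  have [[G0 [CG0 G0ne]]|C0] := pselect (exists G, C G /\ G !=set0); last first.
    left; rewrite -subset0 => u [G CG Gu]; apply: C0.
    by exists G; split=> //; exists u.
  right; have CG G u : C G -> G u ->
    [/\ forall a u v, G u -> G v -> G (a *: u + v),
      forall e, G (0, e) -> e = 0 & forall x, N x -> G (x, f x)].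
    by move=> /CP[->|].
  split=> [a u v [G CG' Gu] [H CH Hv]|e [G CG' G0e]|x Nx].
  - have [GH|HG] := Ctot _ _ CG' CH.
      by exists H => //; have [HP _ _] := CG _ _ CH Hv; apply: HP => //; apply: GH.
    by exists G => //; have [GP _ _] := CG _ _ CG' Gu; apply: GP => //; apply: HG.
  - by have [_ + _] := CG _ _ CG' G0e; apply.
  - have [u Gu] := G0ne; have [_ _ GN] := CG _ _ CG0 Gu.
    by exists G0 => //; apply: GN.
have {PG} [GP G0 GN] : [/\ forall a u v, G u -> G v -> G (a *: u + v),
      forall e, G (0, e) -> e = 0 & forall x, N x -> G (x, f x)].
  case: PG => // Ge; exfalso; apply: Gmax P0; rewrite Ge; split=> // h.
  by apply: (h (0, f 0)); split=> //; apply: submodule0.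
have G00 : G (0, 0).
  by have := GN _ (submodule0 NS); rewrite (linear_on0 NS fl).
have GZ a u : G u -> G (a *: u) by move=> Gu; rewrite -[a *: u]addr0; apply: GP.
have GD u v : G u -> G v -> G (u + v) by rewrite -{2}[u]scale1r; apply: GP.
have Gfun x e e' : G (x, e) -> G (x, e') -> e = e'.
  move=> Gx Gx'; apply/eqP; rewrite -subr_eq0; apply/eqP/G0.
  have := GP (-1) _ _ Gx' Gx; congr G; apply/eqP; rewrite xpair_eqE /=.
  by rewrite !scaleN1r addNr eqxx addrC eqxx.
have Gtot x : exists e, G (x, e).
  pose J : set R^o := [set a | exists e, G ((a : R) *: x, e)].
  have JS : is_submodule J.
    split; first by exists 0; rewrite scale0r.
    move=> a b c [e Ge] [e' Ge']; exists (a *: e + e').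
    have := GP a _ _ Ge Ge'; congr G; apply/eqP; rewrite xpair_eqE /= eqxx andbT.
    by rewrite scalerDl scalerA.
  have /choice[g gP] (a : R^o) : exists e, J a -> G ((a : R) *: x, e).
    have [[e Ge]|nJ] := pselect (J a); first by exists e.
    by exists 0.
  have gl : linear_on J g.
    move=> a b c Jb Jc; apply: (Gfun ((a * b + c) *: x)).
      by apply: gP; apply: JS.2.
    have := GP a _ _ (gP _ Jb) (gP _ Jc); congr G; apply/eqP.
    by rewrite xpair_eqE /= eqxx andbT scalerDl scalerA.
  have [e eP] := Ebaer JS gl.
  pose G' : set (M * E) := [set u | exists a v, G v /\ u = a *: (x, e) + v].
  suff G'G : G' `<=` G.
    by exists e; apply: G'G; exists 1, 0; rewrite scale1r addr0.
  have GG' : G `<=` G' by move=> u Gu; exists 0, u; rewrite scale0r add0r.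
  apply: contrapT => nG'; apply: (Gmax G') => //.
  right; split=> [a _ _ [b [u [Gu ->]]] [c [v [Gv ->]]]|e' [a [[y z] [Gyz]]]|y Ny].
  - exists (a * b + c), (a *: u + v); split; first exact: GP.
    by rewrite scalerDl scalerDr scalerA addrACA.
  - move=> [/esym/eqP]; rewrite addr_eq0 => /eqP ax ->.
    have Gax : G (a *: x, - z).
      have := GZ (-1) _ Gyz; congr G; apply/eqP.
      by rewrite xpair_eqE /= !scaleN1r ax !eqxx.
    have Ja : J a by exists (- z).
    have := Gfun _ _ _ (gP _ Ja) Gax; rewrite (eP a Ja) => ->.
    by rewrite addNr.
  - exact/GG'/GN.
have [h hP] := choice Gtot.
have hl : linear h.
  move=> a x y; apply: (Gfun (a *: x + y)); first exact: hP.
  by have := GP a _ _ (hP x) (hP y).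
by exists (linear_map hl) => x Nx; apply: (Gfun x); [apply: hP|apply: GN].
Qed.

Lemma baer_injective : injective_module E.
Proof.
move=> M N f g fI.
have fS := range_submodule f.
have /choice[k kP] y : exists e, forall x, y = f x -> e = g x.
  have [[x ->]|nx] := pselect (exists x, y = f x).
    by exists (g x) => x' /fI->.
  by exists 0 => x yx; case: nx; exists x.
have [|h hP] := baer_extend fS (f := k).
  move=> a _ _ [x _ <-] [y _ <-].
  rewrite (kP (f x) x erefl) (kP (f y) y erefl).
  by rewrite (kP _ (a *: x + y)) ?linearP.
by exists h => x /=; rewrite hP ?(kP _ x) //; exists x.
Qed.

End Baer.

Lemma baer_prod (R : pzRingType) (E : lmodType R) (T : Type) :
  baer E -> baer (T -> E).
Proof.
move=> Eb J f JS fl.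
have /choice[e eP] t : exists e, forall a : R, J a -> f a t = a *: e.
  by apply: (Eb J (fun a => f a t)) => // a x y Jx Jy; rewrite fl.
by exists e => a Ja; apply/funext => t; rewrite eP.
Qed.

Lemma int_ideal_principal (J : set int^o) : is_submodule J ->
  exists k : nat, forall n : int, J n <-> (k%:Z %| n)%Z.
Proof.
move=> JS; have JM a n : J n -> J (a * n) by apply: (submoduleZ a JS).
have [[n [Jn n0]]|J0] := pselect (exists n : int, J n /\ n != 0); last first.
  exists 0%N => n; rewrite dvd0z; split=> [Jn|/eqP ->]; last exact: submodule0 JS.
  by apply: contraT => n0; case: J0; exists n.
have Jabs : exists k : nat, (0 < k)%N && `[< J k%:Z >].
  exists `|n|%N; rewrite absz_gt0 n0; apply/asboolP.
  by rewrite abszE normrEsg; apply: JM.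
have [k /andP[k0 /asboolP Jk] kmin] := ex_minnP Jabs.
exists k => a; split=> [Ja|/dvdzP[q ->]]; last exact: JM.
apply/dvdz_mod0P; apply/eqP; apply: contraT => r0.
have kpos : k%:Z != 0 by rewrite eqz_nat -lt0n.
have Jr : J (a %% k)%Z.
  have -> : (a %% k)%Z = a - (a %/ k)%Z * k%:Z by rewrite {2}(divz_eq a k) addrC addKr.
  by apply: (submoduleB JS) => //; apply: JM.
have := kmin `|(a %% k)%Z|%N; rewrite absz_gt0 r0 /= gez0_abs ?modz_ge0 //.
move=> /(_ (asboolT Jr)); rewrite leqNgt -ltz_nat gez0_abs ?modz_ge0 //.
by rewrite ltz_pmod.
Qed.

Definition integer_set : set (zmodule rat) := [set x | exists n : int, x = n%:~R].

Lemma integer_submodule : is_submodule integer_set.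
Proof.
split=> [|a _ _ [m ->] [n ->]]; first by exists 0.
by exists (a * m + n); rewrite scalezrE -mulrzl rmorphD rmorphM.
Qed.

Definition rat_mod_int : lmodType int :=
  quotient_module (Submodule integer_submodule).

Definition rat_pi : {linear zmodule rat -> rat_mod_int} :=
  @quot_pi _ _ (Submodule integer_submodule).

(** Divisibility: a representative of the value at the generator [k] of the ideal is divided by [k];
    for [k = 0] the ideal is zero. *)
Lemma rat_mod_int_baer : baer rat_mod_int.
Proof.
move=> J f JS fl; have [k kP] := int_ideal_principal JS.
have Jk : J k by apply/kP.
have [x fk] := quot_pi_surj (f k).
exists (rat_pi ((x : rat) / k%:R)) => a /kP/dvdzP[q ->].
have [->|k0] := eqVneq k 0%N; first by rewrite mulr0 scale0r (linear_on0 JS fl).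
have -> : f (q * k%:Z) = q *: f k by apply: (linear_onZ JS fl).
rewrite fk -!linearZ /=; congr (quot_pi _ _).
have xk : (x : rat) / k%:R *+ k = x by rewrite -[LHS]mulr_natr divfK ?pnatr_eq0.
by rewrite !scalezrE [q * _]mulrC mulrzA -pmulrn xk.
Qed.

(** * Embedding a ring in an injective module by characters *)

Section CharacterModule.
Variable A : comPzRingType.

(** A name of its own lets [Hom_Z(A, Q/Z)] carry the structure of a module over [A] rather than over
    [int]. *)
Definition character_module : Type := {linear zmodule A -> rat_mod_int}.
HB.instance Definition _ := GRing.Zmodule.on character_module.
Implicit Types (a b c : A) (chi : character_module).

Definition char_eval chi (b : A) : rat_mod_int :=
  (chi : {linear zmodule A -> rat_mod_int}) b.

Lemma char_ext chi chi' : char_eval chi =1 char_eval chi' -> chi = chi'.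
Proof. by move=> h; apply: linear_ext. Qed.

Lemma char_scale_linear a chi :
  linear (fun b : zmodule A => char_eval chi ((b : A) * a)).
Proof.
move=> n b c; rewrite /char_eval -linearP /=; congr (chi _).
by rewrite mulrDl !scalezrE mulrzAl.
Qed.

Definition char_scale a chi : character_module :=
  linear_map (char_scale_linear a chi).

Lemma char_scaleA a b chi : char_scale a (char_scale b chi) = char_scale (a * b) chi.
Proof. by apply: char_ext => c; rewrite /char_eval /= mulrA. Qed.

Lemma char_scale1 : left_id 1 char_scale.
Proof. by move=> chi; apply: char_ext => c; rewrite /char_eval /= mulr1. Qed.

Lemma char_scaleDr : right_distributive char_scale +%R.
Proof. by move=> a chi chi'; apply: char_ext. Qed.

Lemma char_scaleDl chi : {morph char_scale^~ chi : a b / a + b}.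
Proof.
move=> a b; apply: char_ext => c; rewrite /char_eval /= mulrDr.
exact: linearD.
Qed.

HB.instance Definition _ := GRing.Zmodule_isLmodule.Build A character_module
  char_scaleA char_scale1 char_scaleDr char_scaleDl.

Lemma char_scaleE a chi b : char_eval (a *: chi) b = char_eval chi (b * a).
Proof. by []. Qed.

(* [Hom_A(M, Hom_Z(A, Q/Z)) = Hom_Z(M, Q/Z)], evaluating at [1]. *)
Lemma character_module_baer : baer character_module.
Proof.
move=> J f JS fl.
pose g (a : zmodule A) : rat_mod_int := char_eval (f a) 1.
have JSz : is_submodule (J : set (zmodule A)).
  split=> [|n a b Ja Jb]; first exact: submodule0 JS.
  apply: (submoduleD JS) => //; rewrite scalezrE -mulrzl.
  exact: (submoduleZ n%:~R JS).
have gl : linear_on (J : set (zmodule A)) g.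
  move=> n a b Ja Jb; rewrite /g scalezrE -mulrzl.
  have -> : f (n%:~R * a + b) = (n%:~R : A) *: f a + f b by exact: fl.
  rewrite -[LHS]/(char_eval (n%:~R *: f a) 1 + char_eval (f b) 1).
  rewrite char_scaleE mul1r /char_eval -linearZ; congr (f a _ + _).
have [h hg] := baer_extend rat_mod_int_baer JSz gl.
exists (h : character_module) => a Ja; apply: char_ext => b.
rewrite char_scaleE -[RHS]/(h (b * a)) hg; last exact: (submoduleZ b JS).
rewrite /g (_ : f (b * a) = b *: f a) ?char_scaleE ?mul1r //.
exact: (linear_onZ JS fl).
Qed.

(** A nonzero [a] has a nonzero character on the cyclic group it generates, and this extends to [A]
    because [Q/Z] is injective. *)
Lemma character_separates a : (forall chi, char_eval chi a = 0) -> a = 0.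
Proof.
move=> ha; pose I : set int^o := [set n | a *~ n = 0].
have IS : is_submodule I.
  split=> [|m n k In Ik]; first by rewrite /I /= mulr0z.
  by rewrite /I /= mulrzDr [_ *: _]mulrC mulrzA In mul0rz add0r.
have [k kP] := int_ideal_principal IS.
apply: contrapT => a0.
have k1 : k != 1%N.
  by apply/eqP => k1; apply: a0; rewrite -[a]mulr1z; apply/kP; rewrite k1.
(* [k] is the order of [a], or 0 if infinite, when 2 serves instead. Then [1/k'] is nonzero in
   [Q/Z], and every integer that kills [a] kills it. *)
pose k' : nat := if k == 0%N then 2 else k.
have k'0 : k' != 0%N by rewrite /k'; case: ifP => // ->.
have k'1 : k' != 1%N by rewrite /k'; case: ifP.
have k'Q : (k'%:R : rat) != 0 by rewrite pnatr_eq0.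
pose d : rat_mod_int := rat_pi (k'%:R^-1 : rat).
have d0 : d <> 0.
  move=> /quot_pi_eq0[n nE]; have : (n * k'%:Z)%:~R = 1 :> rat.
    by rewrite rmorphM /= -nE mulVf.
  rewrite -[1]/(1%:~R) => /intr_inj nk.
  have : (k'%:Z %| 1)%Z by apply/dvdzP; exists n.
  by rewrite dvdz1 absz_nat (negPf k'1).
have dI n : a *~ n = 0 -> n *: d = 0.
  move=> /kP kn; rewrite /d -linearZ; apply/quot_pi_eq0.
  have /dvdzP[q ->] : (k'%:Z %| n)%Z.
    move: kn; rewrite /k'; case: eqP => // ->.
    by rewrite dvd0z => /eqP ->; rewrite dvdz0.
  by exists q; rewrite scalezrE -mulrzl rmorphM /= mulfK.
pose N : set (zmodule A) := [set b | exists n, b = a *~ n].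
have NS : is_submodule N.
  split=> [|m _ _ [n ->] [p ->]]; first by exists 0.
  by exists (n * m + p); rewrite mulrzDr mulrzA.
have /choice[f fP] (b : zmodule A) : exists e : rat_mod_int, forall n, b = a *~ n -> e = n *: d.
  have [[n bE]|nN] := pselect (N b); last by exists 0 => n bE; case: nN; exists n.
  exists (n *: d) => p bE'; apply/eqP; rewrite -subr_eq0 -scalerBl; apply/eqP/dI.
  by rewrite mulrzBr -bE -bE' subrr.
have [|h hf] := baer_extend rat_mod_int_baer NS (f := f).
  move=> m _ _ [n ->] [p ->]; rewrite (fP _ n erefl) (fP _ p erefl).
  rewrite (fP _ (m * n + p)); last by rewrite scalezrE mulrzDr mulrC mulrzA.
  by rewrite scalerDl scalerA.
have := ha (h : character_module); rewrite /char_eval hf; last by exists 1.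
by rewrite (fP _ 1) // scale1r.
Qed.

(** The target is the product of copies of the character module indexed by all characters;
    evaluating the component at [chi] on 1 recovers [chi a]. *)
Definition char_embed a : character_module -> character_module :=
  fun chi => a *: chi.

Lemma char_embed_linear : linear (char_embed : A^o -> character_module -> character_module).
Proof.
by move=> a b c; apply/funext => chi; rewrite /char_embed /= scalerDl -scalerA.
Qed.

Lemma char_embed_inj a : char_embed a = 0 -> a = 0.
Proof.
move=> a0; apply: character_separates => chi.
by have /(congr1 (fun F => char_eval (F chi) 1)) := a0; rewrite char_scaleE mul1r.
Qed.

End CharacterModule.

Lemma self_embedding (A : comPzRingType) :
  exists (E : lmodType A) (iota : {linear A^o -> E}), baer E /\ forall a, iota a = 0 -> a = 0.
Proof.
exists (character_module A -> character_module A), (linear_map (@char_embed_linear A)).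
split; first exact: baer_prod (@character_module_baer A).
by move=> a; apply: (@char_embed_inj A a).
Qed.

(** * Vectors with entries in a module and dimension shifting *)

Section ModuleVectors.
Variables (A : comPzRingType) (I : lmodType A).

Definition mulmv a b (M : 'M[A]_(a, b)) (x : 'I_b -> I) : 'I_a -> I :=
  fun i => \sum_j M i j *: x j.

Lemma mulmvA a b c (M : 'M[A]_(a, b)) (N : 'M[A]_(b, c)) x :
  mulmv (M *m N) x = mulmv M (mulmv N x).
Proof.
apply/funext => i; rewrite /mulmv.
under eq_bigr => j _ do rewrite mxE scaler_suml.
rewrite exchange_big /=; apply: eq_bigr => k _.
by rewrite scaler_sumr; apply: eq_bigr => j _; rewrite scalerA.
Qed.

Lemma mulmv0l a b (x : 'I_b -> I) : mulmv (0 : 'M_(a, b)) x = 0.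
Proof.
by apply/funext => i; rewrite /mulmv big1 // => j _; rewrite mxE scale0r.
Qed.

Lemma mulmv0r a b (M : 'M[A]_(a, b)) : mulmv M 0 = 0.
Proof.
by apply/funext => i; rewrite /mulmv big1 // => j _; rewrite scaler0.
Qed.

Lemma mulmvB a b (M : 'M[A]_(a, b)) x y : mulmv M (x - y) = mulmv M x - mulmv M y.
Proof.
apply/funext => i; rewrite /mulmv -[RHS]sumrB; apply: eq_bigr => j _.
exact: scalerBr.
Qed.

Lemma mulmv_row a b (M : 'M[A]_(a, b)) x i (k : 'I_1) : mulmv (row i M) x k = mulmv M x i.
Proof. by apply: eq_bigr => j _; rewrite mxE. Qed.

Lemma mulmv_linear b (x : 'I_b -> I) :
  linear (fun v : 'rV[A]_b => mulmv v x ord0).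
Proof.
move=> a u v; rewrite /mulmv scaler_sumr -big_split; apply: eq_bigr => j _.
by rewrite !mxE scalerDl scalerA.
Qed.

End ModuleVectors.

Lemma mulmv_map (A : comPzRingType) (I I' : lmodType A) (d : {linear I -> I'})
    a b (M : 'M[A]_(a, b)) (x : 'I_b -> I) :
  d \o mulmv M x = mulmv M (d \o x).
Proof.
by apply/funext => i; rewrite /= linear_sum; apply: eq_bigr => j _; rewrite linearZ.
Qed.

Lemma mulmv_regular (A : comPzRingType) a b (M : 'M[A]_(a, b)) (x : 'cV[A]_b) :
  mulmv (I := A^o) M (fun j => x j ord0) = fun i => (M *m x) i ord0.
Proof. by apply/funext => i; rewrite mxE. Qed.

(** [N] embeds [A^b / ker N] in [A^c], and [x] defines a map from this quotient to [I]. Its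
    extension to [A^c], evaluated on the basis, is [y]. *)
Lemma injective_col_exact (A : comPzRingType) (I : lmodType A) a b c
    (M : 'M[A]_(a, b)) (N : 'M[A]_(b, c)) (x : 'I_b -> I) :
  injective_module I -> row_exact M N -> mulmv M x = 0 ->
  exists y, x = mulmv N y.
Proof.
move=> Iinj [_ MN] Mx.
have KS : is_submodule [set v : 'rV[A]_b | v *m N = 0].
  split=> [|s u v /= uN vN]; first by rewrite /= mul0mx.
  by rewrite mulmxDl -scalemxAl uN vN scaler0 addr0.
pose Q := quotient_module (Submodule KS).
have [|f fE] := @quot_lift _ _ (Submodule KS) _ (mulmxr N : {linear 'rV_b -> 'rV_c}).
  by [].
have [|g gE] := @quot_lift _ _ (Submodule KS) _ (linear_map (mulmv_linear x)).
  move=> v /MN[u ->]; rewrite -[LHS]/(mulmv (u *m M) x ord0).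
  by rewrite mulmvA Mx mulmv0r.
have fI : injective f.
  apply: linear_inj => q; have [v ->] := quot_pi_surj q.
  by rewrite fE => vN; apply/quot_pi_eq0.
have [h hg] := Iinj _ _ f g fI.
exists (fun k => h (delta_mx ord0 k)); apply/funext => j.
have := hg (quot_pi (Submodule KS) (delta_mx ord0 j)); rewrite /= fE gE /=.
rewrite /mulmv (bigD1 j) //= mxE !eqxx scale1r big1 ?addr0 => [<-|k kj]; last first.
  by rewrite mxE (negPf kj) scale0r.
rewrite (row_sum_delta (delta_mx ord0 j *m N)) linear_sum; apply: eq_bigr => k _.
by rewrite linearZ -rowE mxE.
Qed.

Section FiniteInjectiveDimension.
Variables (A : comPzRingType) (I : nat -> lmodType A)
  (d : forall i, {linear I i -> I i.+1}) (n : nat).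
Hypotheses (Iinj : forall i, injective_module (I i))
  (Iexact : forall i, exact_at (d i) (d i.+1))
  (Izero : forall i, (n < i)%N -> forall x : I i, x = 0).

(* Dimension shifting along the cosyzygies [Z i = ker (d i)]. *)
Lemma cosyzygy_col_exact i k a b c (M : 'M[A]_(a, b)) (N : 'M[A]_(b, c))
    (x : 'I_b -> I i) :
  (n < i + k)%N -> row_exact M N -> exact_chain k N -> d i \o x = 0 ->
  mulmv M x = 0 -> exists y, d i \o y = 0 /\ x = mulmv N y.
Proof.
elim: k i a b c M N x => [|k IHk] i a b c M N x.
  rewrite addn0 => ni _ _ _ _; exists 0.
  by split; apply/funext => j; [rewrite /= linear0|rewrite mulmv0r; apply: Izero].
rewrite addnS -addSn => nik MN [e [P [NP PC]]] dx Mx.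
have [y xE] := injective_col_exact (@Iinj i) MN Mx.
(* The solution [y] need not lie in the kernel of [d i]. Its image does lie in the next cosyzygy and
   is killed by [N], so by induction it is [P] times a vector [d i \o w], and subtracting
   [mulmv P w] corrects [y]. *)
have dy : d i.+1 \o (d i \o y) = 0.
  apply/funext => j /=; have : range (d i) (d i (y j)) by exists (y j).
  by rewrite Iexact.
have Ndy : mulmv N (d i \o y) = 0 by rewrite -mulmv_map -xE.
have [z [dz dyE]] := IHk _ _ _ _ _ _ (d i \o y) nik NP PC dy Ndy.
have /choice[w wP] j : exists w, d i w = z j.
  have : [set z | d i.+1 z = 0] (z j) by have /(congr1 (@^~ j)) := dz.
  by rewrite -Iexact => -[w _ wz]; exists w.
exists (y - mulmv P w); split.
  apply/funext => j; rewrite /= -[(y - _) j]/(y j - mulmv P w j) linearB.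
  have /(congr1 (@^~ j)) /= -> := dyE; have /(congr1 (@^~ j)) /= -> :=
    mulmv_map (d i) P w.
  by rewrite (_ : d i \o w = z) ?subrr //; apply/funext => j' /=.
by rewrite mulmvB -mulmvA (proj1 NP) mulmv0l subr0.
Qed.

End FiniteInjectiveDimension.

Lemma injective_dim_ext_vanish (A : comPzRingType) n :
  injective_dim_le A^o n -> ext_vanish A n.+1.
Proof.
move=> [I [e [d [Iinj einj e0 Iexact Izero]]]] a b c M N MN NC x Mx.
have dex j : d 0%N (e (x j ord0)) = 0.
  have : range e (e (x j ord0)) by exists (x j ord0).
  by rewrite e0.
have [||y [dy exE]] :=
  @cosyzygy_col_exact A I d n Iinj Iexact Izero 0 n.+1 _ _ _ M N
  (e \o (fun j => x j ord0 : A^o)) (leqnn _) MN NC.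
- by apply/funext => j; apply: dex.
- rewrite -mulmv_map mulmv_regular Mx; apply/funext => j /=.
  by rewrite mxE linear0.
have /choice[z zP] j : exists z, e z = y j.
  have : [set y | d 0%N y = 0] (y j) by have /(congr1 (@^~ j)) := dy.
  by rewrite -e0 => -[z _ zy]; exists z.
exists (\col_j z j); apply/colP => j; apply: einj.
have /(congr1 (@^~ j)) /= -> := exE.
have -> : y = e \o z by apply/funext => k /=.
rewrite -mulmv_map /=; congr (e _); rewrite mxE.
by apply: eq_bigr => k _; rewrite mxE.
Qed.

Lemma injective_module0 (A : pzRingType) (Z : lmodType A) :
  (forall z : Z, z = 0) -> injective_module Z.
Proof.
move=> Z0 M N f g _; exists 0 => x.
by rewrite [LHS]Z0 [RHS]Z0.
Qed.

(** * Injectivity of E/A and injective dimension at most one *)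

Section Cosyzygy.
Variables (A : comPzRingType) (E : lmodType A) (iota : {linear A^o -> E}).
Hypotheses (Anoeth : noetherian A) (A1 : ext_vanish A 1).
Hypotheses (Ebaer : baer E) (iota0 : forall a, iota a = 0 -> a = 0).

Definition cosyzygy : lmodType A :=
  quotient_module (Submodule (range_submodule iota)).

(** This is [Ext^1(A/J, E/A) = Ext^2(A/J, A) = 0], computed on syzygies of generators of [J]. *)
Lemma cosyzygy_baer : baer cosyzygy.
Proof.
move=> J f JS fl; have [s sE] := Anoeth JS.
pose n := size s; pose M0 : 'cV[A]_n := \col_i s`_i.
have Jsum (b : 'rV_n) : J ((b *m M0) ord0 ord0).
  rewrite sE; exists (fun i => b ord0 i); rewrite mxE.
  by apply: eq_bigr => i _; rewrite !mxE.
have sumJ t : J t -> exists b : 'rV_n, t = (b *m M0) ord0 ord0.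
  rewrite sE => -[b ->]; exists (\row_i b i); rewrite mxE.
  by apply: eq_bigr => i _; rewrite !mxE.
have Js i : (i < n)%N -> J s`_i.
  by move=> ?; rewrite sE; apply/mem_generated/mem_nth.
have [a1 [M1 M10]] := left_kernel Anoeth M0.
have [a2 [M2 M21]] := left_kernel Anoeth M1.
pose pi : {linear E -> cosyzygy} := quot_pi (Submodule (range_submodule iota)).
have /choice[e0 e0P] (i : 'I_n) : exists e, f s`_i = pi e by apply: quot_pi_surj.
have pi_e0 (b : 'rV_n) : pi (mulmv b e0 ord0) = f ((b *m M0) ord0 ord0).
  rewrite linear_sum mxE /= (linear_on_sum JS fl) => [|i]; last first.
    by rewrite mxE; apply: (submoduleZ (b ord0 i) JS); apply: Js.
  apply: eq_bigr => i _; rewrite linearZ -e0P mxE.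
  exact/esym/(linear_onZ JS fl (b ord0 i) (Js i (ltn_ord i))).
(* The lift [e0] of [f] to [E] need not respect the syzygies; its defect lies in the image of [A],
   where it is the cocycle [c]. *)
have /choice[c cP] (l : 'I_a1) : exists c, iota c = mulmv M1 e0 l.
  have : pi (mulmv M1 e0 l) = 0.
    rewrite -(mulmv_row _ _ _ ord0) pi_e0 -row_mul (proj1 M10) row0 mxE.
    exact: linear_on0 JS fl.
  by move=> /quot_pi_eq0[c _ cE]; exists c.
have iota_mul a b (M : 'M[A]_(a, b)) (x : 'cV_b) i :
    iota ((M *m x) i ord0) = mulmv M (fun j => iota (x j ord0)) i.
  have := congr1 (@^~ i) (mulmv_map iota M (fun j => x j ord0 : A^o)).
  by rewrite /= mulmv_regular.
have [|w wE] := A1 M21 (ex_intro _ _ (ex_intro _ M0 (conj M10 I))) (x :=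
  \col_l c l).
  apply/colP => k; rewrite [RHS]mxE; apply: iota0; rewrite iota_mul.
  have -> : (fun l => iota ((\col_l' c l') l ord0)) = mulmv M1 e0.
    by apply/funext => l; rewrite mxE cP.
  by rewrite -mulmvA (proj1 M21) mulmv0l.
(* Subtracting the cochain [w] that bounds [c] makes the lift respect the syzygies and leaves its
   class in [E/A] unchanged. *)
pose e1 : 'I_n -> E := e0 - (fun i => iota (w i ord0)).
have M1e1 : mulmv M1 e1 = 0.
  rewrite mulmvB; apply/funext => l.
  by rewrite -[LHS]/(mulmv M1 e0 l - mulmv M1 _ l) -iota_mul -wE mxE cP subrr.
have /choice[g gP] (t : A^o) : exists e, forall b : 'rV_n,
    t = (b *m M0) ord0 ord0 -> e = mulmv b e1 ord0.
  have [[b tE]|nt] := pselect (exists b : 'rV_n, t = (b *m M0) ord0 ord0);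
    last first.
    by exists 0 => b tE; case: nt; exists b.
  exists (mulmv b e1 ord0) => b' tE'; apply/eqP; rewrite -subr_eq0.
  rewrite -[X in X - _]/(linear_map (mulmv_linear e1) b).
  rewrite -[X in _ - X]/(linear_map (mulmv_linear e1) b') -linearB.
  have [|v ->] := proj2 M10 (b - b').
    by rewrite mulmxBl; apply/rowP => i;
      rewrite (ord1 i) mxE [X in _ + X]mxE -tE -tE' subrr mxE.
  by rewrite /= mulmvA M1e1 mulmv0r.
have [|e eP] := Ebaer JS (f := g).
  move=> a t1 t2 /sumJ[b1 t1E] /sumJ[b2 t2E].
  rewrite (gP _ _ t1E) (gP _ _ t2E) (gP _ (a *: b1 + b2)).
    exact: (linearP (linear_map (mulmv_linear e1))).
  by rewrite t1E t2E mulmxDl -scalemxAl !mxE.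
exists (pi e) => a Ja; rewrite -linearZ -eP //.
have [b aE] := sumJ _ Ja; rewrite (gP _ _ aE) aE -pi_e0.
apply/eqP; rewrite -subr_eq0 -linearB; apply/eqP/quot_pi_eq0.
exists ((b *m w) ord0 ord0) => //; rewrite iota_mul.
rewrite /mulmv -sumrB; apply: eq_bigr => i _; rewrite -scalerBr.
by rewrite /e1 -[X in _ - X]/(e0 i - iota (w i ord0)) subKr.
Qed.

End Cosyzygy.

Lemma ext_vanish_injective_dim (A : comPzRingType) :
  noetherian A -> ext_vanish A 1 -> injective_dim_le A^o 1.
Proof.
move=> Anoeth A1; have [E [iota [Ebaer iota0]]] := self_embedding A.
pose Q := cosyzygy iota.
pose pi : {linear E -> Q} := quot_pi (Submodule (range_submodule iota)).
pose Z : lmodType A := 'rV[A]_0.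
pose I (i : nat) : lmodType A := match i with 0 => E | 1 => Q | _ => Z end%N.
pose d i : {linear I i -> I i.+1} :=
  match i return {linear I i -> I i.+1} with
  | 0 => pi | 1 => (\0 : {linear Q -> Z}) | _ => (\0 : {linear Z -> Z}) end%N.
have Z0 (z : Z) : z = 0 by apply/rowP; case.
exists I, iota, d; split.
- case=> [|[|i]]; first exact: baer_injective.
    by apply: baer_injective; apply: cosyzygy_baer.
  exact: injective_module0.
- exact: linear_inj.
- by apply/seteqP; split=> x /=; [move=> h; apply/quot_pi_eq0|move/quot_pi_eq0].
- case=> [|[|i]]; apply/seteqP; split=> x //= _.
  + by have [y ->] := quot_pi_surj x; exists y.
  + by exists 0; rewrite // [LHS]Z0 [RHS]Z0.
- by case=> [|[|i]] // _ x; apply: Z0.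
Qed.

(** * Localization *)

Section LocalizationMap.
Local Open Scope quotient_scope.
Variables (R : comPzRingType) (p : prime_ideal R).
Notation S := (prime_complement p).
Notation A := (localization_at p).

Lemma prime_complementP s : ~ (p : set R) s -> s \in S.
Proof. by move=> ps; rewrite unfold_in; apply/negP => /set_mem. Qed.

Definition to_localization (r : R) : A := \pi_(localization S) (r, den1 S).

Lemma to_localization_zmod : zmod_morphism to_localization.
Proof.
move=> r s; rewrite -[RHS]/(loc_add _ (loc_opp _)) /to_localization !piE.
by apply/eqP/loc_eqP; exists (den1 S) => /=; ring.
Qed.

Lemma to_localization_monoid : monoid_morphism to_localization.
Proof.
split; first by rewrite -[RHS]/(loc_one S) /to_localization !piE.
move=> r s; rewrite -[RHS]/(loc_mul _ _) /to_localization !piE.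
by apply/eqP/loc_eqP; exists (den1 S) => /=; ring.
Qed.

HB.instance Definition _ := GRing.isZmodMorphism.Build R A to_localization
  to_localization_zmod.
HB.instance Definition _ := GRing.isMonoidMorphism.Build R A to_localization
  to_localization_monoid.

Lemma to_localization_unit s : ~ (p : set R) s -> exists y : A, y * to_localization s = 1.
Proof.
move=> /prime_complementP sS; exists (\pi_(localization S) (1, exist _ s sS)).
rewrite -[LHS]/(loc_mul _ _) -[RHS]/(loc_one S) /to_localization !piE.
by apply/eqP/loc_eqP; exists (den1 S) => /=; ring.
Qed.

Lemma to_localization_frac (x : A) :
  exists r s, ~ (p : set R) s /\ to_localization s * x = to_localization r.
Proof.
elim/quotW: x => -[r [s sS]]; exists r, s.
split; first by move: sS; rewrite unfold_in => /negP + ps; apply; apply/mem_set.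
rewrite -[LHS]/(loc_mul _ _) /to_localization !piE.
by apply/eqP/loc_eqP; exists (den1 S) => /=; ring.
Qed.

Lemma to_localization_eq0 r : to_localization r = 0 -> exists s, ~ (p : set R) s /\ s * r = 0.
Proof.
rewrite -[RHS]/(loc_zero S) /to_localization !piE => /eqP/loc_eqP[[t tS] /=].
rewrite !mulr1 subr0 => tr; exists t; split=> //.
by move: tS; rewrite unfold_in => /negP + pt; apply; apply/mem_set.
Qed.

End LocalizationMap.

(** * Ideals and exact matrices along a map with the properties of a localization *)

Section LocalizationTransfer.
Variables (R A : comPzRingType) (p : set R) (rho : {rmorphism R -> A}).
Hypotheses (Rnoeth : noetherian R) (pp : is_prime_ideal p).
Hypotheses (rho_unit : forall s, ~ p s -> exists y, y * rho s = 1)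
  (rho_frac : forall x, exists r s, ~ p s /\ rho s * x = rho r)
  (rho_eq0 : forall r, rho r = 0 -> exists s, ~ p s /\ s * r = 0).

Lemma rho_ideal_frac (J : set A) s x : is_ideal J -> ~ p s -> J (rho s * x) -> J x.
Proof.
move=> JI /rho_unit[y ys] Jsx; rewrite -[x]mul1r -ys -mulrA.
exact: idealM.
Qed.

Lemma localization_noetherian : noetherian A.
Proof.
move=> J JI; pose J0 : set R := [set r | J (rho r)].
have J0I : is_ideal J0.
  apply: ideal_ofP => [|a b Ja Jb|a b Jb]; rewrite /J0 /=.
  - by rewrite rmorph0; apply: ideal0.
  - by rewrite rmorphD; apply: idealD.
  - by rewrite rmorphM; apply: idealM.
have [s sE] := Rnoeth J0I; exists [seq rho r | r <- s].
apply/seteqP; split; last first.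
  apply: (@generated_min A A^o) => // _ /mapP[r rs ->].
  by have : J0 r by rewrite sE; apply: mem_generated.
move=> x Jx; have [r [t [pt tx]]] := rho_frac x.
have : J0 r by rewrite /J0 /= -tx; apply: idealM.
rewrite sE => -[c rE].
pose G := @generated A A^o [seq rho r | r <- s].
have GS : is_ideal G by apply: generated_submodule.
apply: (rho_ideal_frac (J := G) GS pt).
rewrite tx rE rmorph_sum.
apply: (@submodule_sum A A^o) => // i; rewrite rmorphM; apply: idealM => //.
by apply/mem_generated/map_f/mem_nth.
Qed.

Lemma contraction_prime (q : set A) :
  is_prime_ideal q -> is_prime_ideal [set r | q (rho r)].
Proof.
move=> [qI q1 qM]; split.
- apply: ideal_ofP => [|a b Ja Jb|a b Jb] /=.
  + by rewrite rmorph0; apply: ideal0.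
  + by rewrite rmorphD; apply: idealD.
  + by rewrite rmorphM; apply: idealM.
- by rewrite /= rmorph1.
- by move=> x y /=; rewrite rmorphM; apply: qM.
Qed.

(** Contraction keeps inclusions of primes strict, since by clearing denominators an ideal of [A] is
    determined by its contraction. *)
Lemma localization_krull_dim n : krull_dim_le R n -> krull_dim_le A n.
Proof.
move=> dimR k c cP.
apply: (dimR k (fun i => PrimeIdeal (contraction_prime (prime_idealP (c i))))).
move=> i j ij; have [cij nij] := cP i j ij; split=> [r /= /cij //|h].
apply: nij => x cx; have [r [s [ps sx]]] := rho_frac x.
have cI := prime_ideal_ideal (prime_idealP (c i)).
apply: (rho_ideal_frac cI ps); rewrite sx; apply: h => /=.
by rewrite -sx; apply: idealM => //; apply: prime_ideal_ideal (prime_idealP (c j)).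
Qed.

Definition extended_ideal : set A :=
  [set x | exists r s, [/\ p r, ~ p s & rho s * x = rho r]].

Lemma extended_ideal_rho r : extended_ideal (rho r) -> p r.
Proof.
move=> [a [s [pa ps]]]; rewrite -rmorphM => /eqP; rewrite -subr_eq0 -rmorphB.
move=> /eqP/rho_eq0[t [pt ts]]; have [pI _ pM] := pp.
have : p (t * (s * r)).
  by rewrite -[t * (s * r)](subrK (t * a)) -mulrBr ts add0r; apply: idealM.
by case/pM => // /pM[].
Qed.

Lemma extended_ideal_prime : is_prime_ideal extended_ideal.
Proof.
have [pI p1 pM] := pp; split.
- apply: ideal_ofP.
  + by exists 0, 1; rewrite !rmorph0 mulr0; split=> //; apply: ideal0.
  + move=> x y [r [s [pr ps sx]]] [r' [s' [pr' ps' sy]]].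
    exists (s' * r + s * r'), (s * s'); split.
    * by apply: idealD => //; apply: idealM.
    * exact: prime_notM.
    * by rewrite rmorphD !rmorphM -sx -sy; ring.
  + move=> a x [r [s [pr ps sx]]]; have [r' [s' [ps' sa]]] := rho_frac a.
    exists (r' * r), (s' * s); split.
    * exact: idealM.
    * exact: prime_notM.
    * by rewrite !rmorphM -sx -sa; ring.
- by rewrite -(rmorph1 rho) => /extended_ideal_rho.
- move=> x y [a [t [pa pt txy]]].
  have [r [s [ps sx]]] := rho_frac x; have [r' [s' [ps' sy]]] := rho_frac y.
  have : extended_ideal (rho (t * (r * r'))).
    exists (s * s' * a), 1; split=> //; first exact: idealM.
    by rewrite rmorph1 mul1r !rmorphM -txy -sx -sy; ring.
  move=> /extended_ideal_rho/pM[//|/pM[pr|pr']].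
    by left; exists r, s.
  by right; exists r', s'.
Qed.

Lemma extended_ideal_local x : ~ extended_ideal x -> exists y, y * x = 1.
Proof.
move=> nx; have [r [s [ps sx]]] := rho_frac x.
have [|y yr] := rho_unit (s := r); first by move=> pr; apply: nx; exists r, s.
by exists (y * rho s); rewrite -mulrA sx.
Qed.

Lemma common_denominator (I : finType) (P : I -> R -> Prop) :
  (forall i s t, P i s -> P i (t * s)) -> (forall i, exists s, ~ p s /\ P i s) ->
  exists s, ~ p s /\ forall i, P i s.
Proof.
move=> PM /choice[s sP]; exists (\prod_i s i); split.
  elim/big_ind: _ => [|x y px py|i _]; first by case: pp.
    exact: prime_notM.
  by case: (sP i).
by move=> i; rewrite (bigD1 i) //= mulrC; apply: PM; case: (sP i).
Qed.

Lemma matrix_frac a b (M : 'M[A]_(a, b)) :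
  exists s (N : 'M[R]_(a, b)), ~ p s /\ rho s *: M = map_mx rho N.
Proof.
have [|[i j]|s [ps sP]] := @common_denominator ('I_a * 'I_b)%type
    (fun ij s => exists r, rho s * M ij.1 ij.2 = rho r).
- by move=> ij s t [r rE]; exists (t * r); rewrite !rmorphM -rE mulrA.
- by have [r [s [ps sE]]] := rho_frac (M i j); exists s; split=> //; exists r.
have [N NE] := choice sP.
exists s, (\matrix_(i, j) N (i, j)); split=> //.
by apply/matrixP => i j; rewrite !mxE (NE (i, j)).
Qed.

Lemma matrix_eq0 a b (N : 'M[R]_(a, b)) :
  map_mx rho N = 0 -> exists s, ~ p s /\ s *: N = 0.
Proof.
move=> N0.
have [|[i j]|s [ps sP]] := @common_denominator ('I_a * 'I_b)%type
    (fun ij s => s * N ij.1 ij.2 = 0).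
- by move=> ij s t sN; rewrite -mulrA sN mulr0.
- by apply: rho_eq0; have /matrixP/(_ i j) := N0; rewrite !mxE.
by exists s; split=> //; apply/matrixP => i j; rewrite !mxE (sP (i, j)).
Qed.

Lemma row_exact_localization a b c (M : 'M[R]_(a, b)) (N : 'M[R]_(b, c)) :
  row_exact M N -> row_exact (map_mx rho M) (map_mx rho N).
Proof.
move=> [MN hMN]; split; first by rewrite -map_mxM MN map_mx0.
move=> v vN; have [s [w [ps sv]]] := matrix_frac v.
have [|t [pt twN]] := @matrix_eq0 _ _ (w *m N).
  by rewrite map_mxM -sv -scalemxAl vN scaler0.
have [|u uE] := hMN (t *: w); first by rewrite -scalemxAl.
have [y yE] := rho_unit (prime_notM pp pt ps).
exists (y *: map_mx rho u).
rewrite -scalemxAl -map_mxM -uE map_mxZ -sv !scalerA.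
by rewrite -mulrA -rmorphM yE scale1r.
Qed.

Lemma exact_chain_localization k b c (N : 'M[R]_(b, c)) :
  exact_chain k N -> exact_chain k (map_mx rho N).
Proof.
elim: k b c N => // k IHk b c N [d [P [NP PC]]].
exists d, (map_mx rho P); split; first exact: row_exact_localization.
exact: IHk.
Qed.

Lemma col_exact_localization a b c (M : 'M[R]_(a, b)) (N : 'M[R]_(b, c)) (x : 'cV_b) :
  col_exact (map_mx rho M) (map_mx rho N) -> M *m x = 0 ->
  exists s, ~ p s /\ exists y, s *: x = N *m y.
Proof.
move=> MN Mx; have [|u xE] := MN (map_mx rho x).
  by rewrite -map_mxM Mx map_mx0.
have [s [w [ps su]]] := matrix_frac u.
have [|t [pt tsw]] := @matrix_eq0 _ _ (s *: x - N *m w).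
  by rewrite map_mxB map_mxZ map_mxM xE -su -scalemxAr subrr.
exists (t * s); split; first exact: prime_notM.
exists (t *: w); apply/eqP; rewrite -subr_eq0 -scalemxAr -scalerA -scalerBr.
exact/eqP.
Qed.

(** The matrices over [A] need not come from [R], but [P] does up to a unit. A resolution of its
    numerator over [R] is localized and compared with the given one. *)
Lemma ext_vanish_localization : ext_vanish R 1 -> ext_vanish A 1.
Proof.
move=> R1 a b c M N MN [d [P [NP _]]] x Mx.
have [s0 [P0 [ps0 sP]]] := matrix_frac P.
have [y0 y0s] := rho_unit ps0.
have [b1 [N1 NP1]] := left_kernel Rnoeth P0.
have [b2 [N2 N21]] := left_kernel Rnoeth N1.
(* [T], [T'] and [T2] are comparison maps between the two resolutions of the same module; [T]
   carries the cocycle [x] to one of the localized resolution. *)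
have [T TE] : exists T, map_mx rho N1 = T *m N.
  apply: row_exact_mx NP _.
  have -> : P = y0 *: map_mx rho P0 by rewrite -sP scalerA y0s scale1r.
  by rewrite -scalemxAr -map_mxM (proj1 NP1) map_mx0 scaler0.
have [T' NE] : exists T', N = T' *m map_mx rho N1.
  apply: row_exact_mx (row_exact_localization NP1) _.
  by rewrite -sP -scalemxAr (proj1 NP) scaler0.
have [T2 T2E] : exists T2, map_mx rho N2 *m T = T2 *m M.
  apply: row_exact_mx MN _.
  by rewrite -mulmxA -TE -map_mxM (proj1 N21) map_mx0.
have N2Tx : map_mx rho N2 *m (T *m x) = 0.
  by rewrite mulmxA T2E -mulmxA Mx mulmx0.
have [s [w [ps sw]]] := matrix_frac (T *m x).
have [|t [pt tw]] := @matrix_eq0 _ _ (N2 *m w).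
  by rewrite map_mxM -sw -scalemxAr N2Tx scaler0.
have [|u uE] := R1 _ _ _ _ _ N21 (ex_intro _ _ (ex_intro _ P0 (conj NP1 I))) (t *: w).
  by rewrite -scalemxAr.
have [y yE] := rho_unit (prime_notM pp pt ps).
have TxE : T *m x = map_mx rho N1 *m (y *: map_mx rho u).
  rewrite -scalemxAr -map_mxM -uE map_mxZ -sw !scalerA.
  by rewrite -mulrA -rmorphM yE scale1r.
(* The homotopy between [T' *m T] and the identity: as [M *m x = 0], it gives [x = T' *m T *m x]. *)
have [T3 T3E] : exists T3, 1%:M - T' *m T = T3 *m M.
  apply: row_exact_mx MN _.
  by rewrite mulmxBl mul1mx -mulmxA -TE -NE subrr.
exists (y *: map_mx rho u); rewrite NE -mulmxA -TxE mulmxA.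
apply/eqP; rewrite -subr_eq0 -[x in X in X - _]mul1mx -mulmxBl T3E -mulmxA Mx.
by rewrite mulmx0.
Qed.

End LocalizationTransfer.

(** * Gorenstein rings of dimension at most one and vanishing of Ext^2 *)

Lemma ext_vanish_gorenstein (R : comPzRingType) :
  noetherian R -> ext_vanish R 1 -> gorenstein R.
Proof.
move=> Rnoeth R1 p _; exists 1%N.
pose rho : {rmorphism R -> localization_at p} := @to_localization R p.
have unit := @to_localization_unit R p; have frac := @to_localization_frac R p.
apply: ext_vanish_injective_dim.
  exact: (@localization_noetherian R _ p rho).
apply: (@ext_vanish_localization R _ p rho) => //; first exact: prime_idealP.
exact: to_localization_eq0.
Qed.

(** The ideal [K] of multipliers that bring [x] into the image of [N] measures the failure of
    exactness. If proper, it lies in a maximal ideal [m], but vanishing over the localization at [m]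
    puts an element outside [m] in [K]. *)
Lemma gorenstein_ext_vanish (R : comPzRingType) :
  noetherian R -> gorenstein R -> krull_dim_le R 1 -> ext_vanish R 1.
Proof.
move=> Rnoeth Rgor dimR a b c M N MN NC x Mx.
pose K : set R := [set s | exists y, s *: x = N *m y].
have KI : is_ideal K.
  apply: ideal_ofP => [|s t [y sx] [z tx]|s t [y tx]].
  - by exists 0; rewrite scale0r mulmx0.
  - by exists (y + z); rewrite scalerDl sx tx mulmxDr.
  - by exists (s *: y); rewrite -scalerA tx scalemxAr.
suff [y] : K 1 by rewrite scale1r => xE; exists y.
apply: contrapT => K1.
have [||m [[mI m1] Km mmax]] :=
  @noetherian_maximal R Rnoeth (fun J => is_ideal J /\ ~ J 1) K.
- by move=> J [].
- by [].
have mM : is_maximal_ideal m.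
  split=> // J JI mJ; have [J1|nJ1] := pselect (J 1); last by left; apply: mmax.
  right; apply/seteqP; split=> // r _; rewrite -[r]mulr1; exact: idealM.
have mp := maximal_is_prime mM.
pose p := PrimeIdeal mp; have [n An] := Rgor p mM.
pose rho : {rmorphism R -> localization_at p} := @to_localization R p.
have unit := @to_localization_unit R p; have frac := @to_localization_frac R p.
have eq0 := @to_localization_eq0 R p.
have A1 : ext_vanish (localization_at p) 1.
  apply: (@ext_vanish_descent _ (extended_ideal m rho) _ _ _ _ n.+1).
  - exact: (@localization_noetherian R _ m rho).
  - exact: extended_ideal_prime.
  - exact: extended_ideal_local.
  - exact: (@localization_krull_dim R _ m rho).
  - exact: injective_dim_ext_vanish.
have [s [ms Ks]] : exists s, ~ m s /\ K s.
  apply: (@col_exact_localization R _ m rho mp frac eq0 _ _ _ M N x) => //.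
  apply: A1; first exact: (row_exact_localization mp unit frac eq0 MN).
  exact: (exact_chain_localization mp unit frac eq0 NC).
exact/ms/Km.
Qed.

(** * Reflexive and trace modules *)

Section FiniteGeneration.
Variable R : pzRingType.
Implicit Types M N : lmodType R.

Lemma generated_map M N (f : {linear M -> N}) (s : seq M) x :
  generated s x -> generated [seq f y | y <- s] (f x).
Proof.
move=> [c ->]; rewrite linear_sum; apply: submodule_sum.
  exact: generated_submodule.
move=> i; rewrite linearZ; apply: submoduleZ; first exact: generated_submodule.
by apply/mem_generated/map_f/mem_nth.
Qed.

Lemma finitely_generated_surj M N (f : {linear M -> N}) :
  (forall y, exists x, y = f x) -> finitely_generated M -> finitely_generated N.
Proof.
move=> fsurj [s sE]; exists [seq f y | y <- s]; apply/seteqP; split=> // y _.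
by have [x ->] := fsurj y; apply: generated_map; rewrite sE.
Qed.

Lemma pair_inl_linear M N : linear (fun x : M => (x, 0 : N)).
Proof.
by move=> a x y; apply/eqP; rewrite xpair_eqE /= eqxx scaler0 addr0 eqxx.
Qed.

Lemma finitely_generated_pair M N :
  finitely_generated M -> finitely_generated N -> finitely_generated (M * N)%type.
Proof.
move=> [s sE] [t tE].
have linr : linear (fun y : N => (0 : M, y)).
  by move=> a x y; apply/eqP; rewrite xpair_eqE /= eqxx scaler0 addr0 eqxx.
exists ([seq (x, 0) | x <- s] ++ [seq (0, y) | y <- t]).
apply/seteqP; split=> // -[x y] _.
have -> : (x, y) = (x, 0) + (0, y).
  by apply/eqP; rewrite xpair_eqE /= addr0 add0r !eqxx.
apply: submoduleD; first exact: generated_submodule.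
  have : generated s x by rewrite sE.
  move=> /(generated_map (linear_map (@pair_inl_linear M N)));
    apply: generated_sub => z zs.
  by rewrite mem_cat zs.
have : generated t y by rewrite tE.
move=> /(generated_map (linear_map linr)); apply: generated_sub => z zs.
by rewrite mem_cat orbC zs.
Qed.

End FiniteGeneration.

(** * Retracts of reflexive modules and stability of trace submodules *)

Section Reflexivity.
Variable R : comPzRingType.
Implicit Types M X : lmodType R.

(** An identity that exposes an element of the dual module as a linear map, so that it can be
    applied and composed. *)
Definition functional_app M (psi : dual_module M) : {linear M -> R^o} := psi.

Lemma biduality_apply M (m : M) (psi : dual_module M) :
  functional_app (biduality m) psi = functional_app psi m.
Proof. by []. Qed.

Lemma biduality_eq M (m : M) (Phi : dual_module (dual_module M)) :
  (forall psi, functional_app psi m = functional_app Phi psi) -> biduality m = Phi.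
Proof. by move=> h; apply: linear_ext. Qed.

Lemma functional_app_sum M (I : finType) (c : I -> R) (psi : I -> dual_module M) m :
  functional_app (\sum_i c i *: psi i) m = \sum_i c i * functional_app (psi i) m.
Proof.
rewrite -biduality_apply linear_sum; apply: eq_bigr => i _.
by rewrite linearZ.
Qed.

Lemma bijective_of (T U : Type) (f : T -> U) :
  injective f -> (forall y, exists x, f x = y) -> bijective f.
Proof.
move=> finj /choice[g gK]; exists g => // x.
by apply: finj; rewrite gK.
Qed.

Lemma finitely_generated_regular : finitely_generated R^o.
Proof.
exists [:: 1]; apply/seteqP; split=> // x _.
exists (fun=> x); rewrite big_ord1 /=; apply/esym; exact: mulr1.
Qed.

Lemma torsionless_pair M : torsionless M -> torsionless (M * R^o)%type.
Proof.
move=> [Mfg Minj]; split.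
  exact: finitely_generated_pair Mfg finitely_generated_regular.
apply: linear_inj => -[m r] mr0.
have h (psi : dual_module (M * R^o)%type) : functional_app psi (m, r) = 0.
  by rewrite -biduality_apply mr0.
have m0 : m = 0.
  apply: Minj; rewrite linear0; apply: biduality_eq => psi.
  exact: (h (functional_app psi \o fst)).
have r0 : r = 0 := h (snd : {linear (M * R^o)%type -> R^o}).
by rewrite m0 r0.
Qed.

(** Naturality of biduality: a functional on [M^*] is pushed to one on [X^*] along [i], represented
    by an element of [X], and brought back by [r]. *)
Lemma reflexive_retract M X (i : {linear M -> X}) (r : {linear X -> M}) :
  cancel i r -> reflexive_module X -> reflexive_module M.
Proof.
move=> ir [Xfg [g Xg gX]]; split.
  by apply: (finitely_generated_surj (f := r)) Xfg => m; exists (i m); rewrite ir.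
apply: bijective_of.
  apply: linear_inj => m m0.
  suff im0 : biduality (i m) = biduality (0 : X).
    by have := congr1 g im0; rewrite !Xg => im; rewrite -(ir m) im linear0.
  rewrite linear0; apply: biduality_eq => psi.
  by have := congr1 (fun F : dual_module (dual_module M) =>
      functional_app F (functional_app psi \o i)) m0.
move=> Phi.
have pl : linear (fun psi : dual_module X => functional_app Phi (functional_app psi \o i)).
  move=> a u v; rewrite -linearP; congr (functional_app Phi _).
  exact: linear_ext.
pose Psi : dual_module (dual_module X) := linear_map pl.
exists (r (g Psi)); apply: biduality_eq => psi.
have /(congr1 (fun F : dual_module (dual_module X) =>
  functional_app F (functional_app psi \o r))) := gX Psi.
rewrite biduality_apply /= => ->; congr (functional_app Phi _).
by apply: linear_ext => m /=; rewrite ir.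
Qed.

(** Every map from [N] to [X] has its image in the trace, hence factors through [iota]; composing
    the factors with [h] gives further maps from [N] to [X]. *)
Lemma trace_submodule_stable M X (iota h : {linear M -> X}) :
  trace_via iota -> forall m, range iota (h m).
Proof.
move=> [iinj [N YE]] m.
have [n [al [x mE]]] : trace_module N (iota m) by rewrite -YE; exists m.
have be_ex (j : 'I_n) : exists be : {linear N -> M}, forall y, iota (be y) = al j y.
  have /choice[b bP] y : exists z, iota z = al j y.
    have : trace_module N (al j y).
      by exists 1%N, (fun=> al j), (fun=> y); rewrite big_ord1.
    by rewrite -YE => -[z _ zE]; exists z.
  have bl : linear b by move=> a u v; apply: iinj; rewrite linearP !bP linearP.
  by exists (linear_map bl).
have [be beE] := choice be_ex.
have -> : m = \sum_j be j (x j).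
  by apply: iinj; rewrite mE linear_sum; apply: eq_bigr => j _; rewrite beE.
rewrite YE; exists n, (fun j => h \o be j), x.
by rewrite linear_sum.
Qed.

(** Stability applies to the map [m |-> r m *: x], which sends the given [m] to [x]. *)
Lemma trace_via_surj M X (iota : {linear M -> X}) (r : {linear M -> R^o}) m :
  r m = 1 -> trace_via iota -> forall x, exists m', iota m' = x.
Proof.
move=> rm tr x.
have hl : linear (fun m => r m *: x).
  by move=> a u v; rewrite linearP scalerDl -scalerA.
have := trace_submodule_stable (linear_map hl) tr m.
by rewrite /= rm scale1r => -[m' _ <-]; exists m'.
Qed.

Lemma reflexive_of_trace M X (iota : {linear (M * R^o)%type -> X}) :
  trace_via iota -> reflexive_module X -> reflexive_module M.
Proof.
move=> tr Xref.
have [|g gK] := choice (trace_via_surj (r := snd) (m := (0, 1)) _ tr); first by [].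
have iinj := proj1 tr.
have gl : linear g by move=> a u v; apply: iinj; rewrite linearP !gK.
apply: (@reflexive_retract M X (iota \o linear_map (@pair_inl_linear _ M R^o)) (fst \o linear_map gl)) => // m /=.
by rewrite (_ : g _ = (m, 0)) //; apply: iinj; rewrite gK.
Qed.

Lemma trace_submodule_self X (Y : set X) : Y = setT -> trace_submodule Y.
Proof.
move=> ->; exists X; apply/seteqP; split=> // x _.
by exists 1%N, (fun=> idfun : {linear X -> X}), (fun=> x); rewrite big_ord1.
Qed.

End Reflexivity.

(** * Reflexivity of torsionless modules and vanishing of Ext^2 *)

Section TorsionlessReflexive.
Variable R : comPzRingType.
Hypothesis Rnoeth : noetherian R.

(* The rows [v] orthogonal to [ker N] form the row space of [N], which is thus
   the dual of [C]; its functional [u *m N |-> u *m x] comes from [C]. *)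
Lemma reflexive_ext_vanish :
  (forall M : lmodType R, torsionless M -> reflexive_module M) -> ext_vanish R 1.
Proof.
move=> refl a b c M N MN [d [P [NP _]]] x Mx.
have WS : is_submodule [set w : 'rV[R]_c | N *m w^T = 0].
  split=> [|s u v /= uN vN]; first by rewrite /= trmx0 mulmx0.
  by rewrite linearP /= mulmxDr -scalemxAr uN vN scaler0 addr0.
pose C : lmodType R := quotient_module (Submodule WS).
pose pi : {linear 'rV[R]_c -> C} := quot_pi (Submodule WS).
have fun_row i : exists psi : dual_module C, forall w,
    functional_app psi (pi w) = (N *m w^T) i ord0.
  have nl : linear (fun w : 'rV[R]_c => (N *m w^T) i ord0 : R^o).
    by move=> s u v; rewrite linearP /= mulmxDr -scalemxAr !mxE.
  have [|g gE] := @quot_lift _ _ (Submodule WS) _ (linear_map nl).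
    by move=> w /= ->; rewrite mxE.
  by exists g.
have [psi psiE] := choice fun_row.
(* The functionals [psi i] given by the rows of [N] separate the points of [C]. *)
have Ctl : torsionless C.
  split.
    apply: (@finitely_generated_surj _ _ _ pi); first exact: quot_pi_surj.
    have [|s sE] := @noetherian_rV R Rnoeth c setT; first by split.
    by exists s.
  apply: linear_inj => q; have [w ->] := quot_pi_surj q; move=> w0.
  apply/quot_pi_eq0; apply/colP => i; rewrite -psiE -biduality_apply.
  by rewrite w0 [RHS]mxE.
have [_ [g _ gK]] := refl C Ctl.
pose row_of (f : dual_module C) : 'rV[R]_c :=
  \row_j functional_app f (pi (delta_mx ord0 j)).
have row_ofE f w : functional_app f (pi w) = (row_of f *m w^T) ord0 ord0.
  rewrite {1}(row_sum_delta w) !linear_sum mxE; apply: eq_bigr => j _.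
  by rewrite !linearZ !mxE mulrC.
have row_ofP f : exists u, row_of f = u *m N.
  apply: (proj2 NP); apply/rowP => j; rewrite [RHS]mxE.
  have : functional_app f (pi (col j P)^T) = 0.
    rewrite (_ : pi _ = 0) ?linear0 //; apply/quot_pi_eq0 => /=.
    by rewrite trmxK colE mulmxA (proj1 NP) mul0mx.
  by rewrite row_ofE trmxK colE mulmxA -colE mxE.
(* The value does not depend on [u], since two choices differ by a row [t *m M] and [M *m x = 0]. *)
have /choice[Phi0 PhiP] (f : dual_module C) : exists e : R^o,
    forall u, row_of f = u *m N -> e = (u *m x) ord0 ord0.
  have [u uE] := row_ofP f; exists ((u *m x) ord0 ord0) => u' u'E.
  have [|t tE] := proj2 MN (u - u'); first by rewrite mulmxBl -uE -u'E subrr.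
  by rewrite -[u](subrK u') tE mulmxDl -mulmxA Mx mulmx0 add0r.
have Phil : linear Phi0.
  move=> s f1 f2; have [u1 u1E] := row_ofP f1; have [u2 u2E] := row_ofP f2.
  rewrite (PhiP _ _ u1E) (PhiP _ _ u2E) (PhiP _ (s *: u1 + u2)).
    by rewrite mulmxDl -scalemxAl !mxE.
  by rewrite mulmxDl -scalemxAl -u1E -u2E; apply/rowP => j; rewrite !mxE.
pose Phi : dual_module (dual_module C) := linear_map Phil.
have [w wE] := quot_pi_surj (g Phi).
exists w^T; apply/colP => i; rewrite -psiE.
have := congr1 (fun F : dual_module (dual_module C) => functional_app F (psi i)) (gK Phi).
rewrite biduality_apply wE => ->; rewrite -[RHS]/(Phi0 (psi i)).
(* [psi i] corresponds to row [i] of [N], so its value under [Phi] is entry [i] of [x]. *)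
rewrite (PhiP _ (delta_mx ord0 i)); first by rewrite -rowE mxE.
rewrite -rowE; apply/rowP => j; rewrite !mxE psiE trmx_delta -colE mxE.
by [].
Qed.

(** Write [M] as [R^n] modulo the rows of [S]. Then [M^*] is [ker S], generated by the columns of
    [G] with relations [H]. The values of [Phi] on these generators form a row killed by [H], which
    Ext vanishing writes as [u *m G]; so [Phi] is evaluation at the class of [u]. *)
Lemma ext_vanish_reflexive (M : lmodType R) :
  ext_vanish R 1 -> torsionless M -> reflexive_module M.
Proof.
move=> R1 [[s sE] Minj]; split; first by exists s.
pose n := size s; pose comb (a : 'rV[R]_n) : M := \sum_i a ord0 i *: s`_i.
have combl : linear comb.
  move=> r u v; rewrite /comb scaler_sumr -big_split; apply: eq_bigr => i _.
  by rewrite !mxE scalerDl scalerA.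
pose lcomb := linear_map combl.
have combP m : exists a, m = lcomb a.
  have : generated s m by rewrite sE.
  move=> [a ->]; exists (\row_i a i).
  by apply: eq_bigr => i _; rewrite mxE.
have [|t tE] := noetherian_rV Rnoeth (N := [set a | lcomb a = 0]).
  split=> [|r u v u0 v0]; first exact: (linear0 lcomb).
  have := linearP lcomb r u v.
  by rewrite (u0 : lcomb u = 0) (v0 : lcomb v = 0) scaler0 addr0.
pose S := \matrix_(i < size t) t`_i.
have S0 i : lcomb (row i S) = 0.
  have : generated t t`_i by apply/mem_generated/mem_nth.
  by rewrite -tE rowK.
have SP a : lcomb a = 0 -> exists u, a = u *m S.
  move=> a0; have : generated t a by rewrite -tE.
  move=> [u ->]; exists (\row_i u i); rewrite mulmx_sum_row.
  by apply: eq_bigr => i _; rewrite mxE rowK.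
have functional (w : 'cV_n) : S *m w = 0 -> exists psi : dual_module M,
    forall a : 'rV_n, functional_app psi (lcomb a) = (a *m w) ord0 ord0.
  move=> Sw; have /choice[psi psiP] m : exists e : R^o, forall a : 'rV_n,
      m = lcomb a -> e = (a *m w) ord0 ord0.
    have [a aE] := combP m; exists ((a *m w) ord0 ord0) => a' a'E.
    have [|u uE] := SP (a - a'); first by rewrite linearB -aE -a'E subrr.
    by rewrite -[a](subrK a') uE mulmxDl -mulmxA Sw mulmx0 add0r.
  have psil : linear psi.
    move=> r m1 m2; have [a1 a1E] := combP m1; have [a2 a2E] := combP m2.
    rewrite (psiP _ _ a1E) (psiP _ _ a2E) (psiP _ (r *: a1 + a2)).
      by rewrite mulmxDl -scalemxAl !mxE.
    by rewrite linearP -a1E -a2E.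
  by exists (linear_map psil) => a; apply: psiP.
have [g [G [SG hG]]] := right_kernel Rnoeth S.
have [h [H [GH hH]]] := right_kernel Rnoeth G.
have cHG : col_exact H^T G^T.
  apply: R1; first exact: row_exact_tr GH hH.
  by exists (size t), S^T; split=> //; apply: row_exact_tr SG hG.
have /choice[psi psiE] (j : 'I_g) : exists psi : dual_module M,
    forall a, functional_app psi (lcomb a) = (a *m G) ord0 j.
  have [|psi psiE] := functional (col j G); first by rewrite colE mulmxA SG mul0mx.
  by exists psi => a; rewrite psiE colE mulmxA -colE mxE.
have combE (y : 'I_g -> R) a : functional_app (\sum_j y j *: psi j) (lcomb a) =
    (a *m G *m \col_j y j) ord0 ord0.
  rewrite functional_app_sum mxE; apply: eq_bigr => j _.
  by rewrite psiE [X in _ = _ * X]mxE mulrC.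
apply: bijective_of => // Phi.
have PhiE (y : 'I_g -> R) : functional_app Phi (\sum_j y j *: psi j) =
    ((\row_j functional_app Phi (psi j)) *m \col_j y j) ord0 ord0.
  rewrite linear_sum mxE; apply: eq_bigr => j _.
  by rewrite linearZ !mxE mulrC.
have [|u uE] := col_exact_trP (v := \row_j functional_app Phi (psi j)) cHG.
  apply/rowP => l; rewrite [RHS]mxE.
  have colH : (\col_j H j l) = col l H by apply/colP => j; rewrite !mxE.
  have := PhiE (fun j => H j l); rewrite colH colE mulmxA -colE [RHS]mxE => <-.
  rewrite (_ : \sum_j _ = 0) ?linear0 //; apply: linear_ext => m.
  have [a ->] := combP m; rewrite -[LHS]/(functional_app _ _) combE colH.
  by rewrite colE mulmxA -(mulmxA a) GH mulmx0 mul0mx mxE.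
exists (lcomb u); apply: biduality_eq => f.
pose w := \col_i functional_app f s`_(i : 'I_n).
have fE a : functional_app f (lcomb a) = (a *m w) ord0 ord0.
  rewrite linear_sum mxE; apply: eq_bigr => i _.
  by rewrite linearZ mxE.
have [|y wE] := hG w.
  apply/row_matrixP => i; rewrite row_mul row0; apply/rowP => j.
  by rewrite (ord1 j) -fE S0 linear0 mxE.
have yE : \col_j y j ord0 = y by apply/colP => j; rewrite mxE.
have -> : f = \sum_j y j ord0 *: psi j.
  apply: linear_ext => m; have [a ->] := combP m.
  rewrite -[LHS]/(functional_app _ _) -[RHS]/(functional_app _ _).
  by rewrite fE combE yE wE mulmxA.
by rewrite PhiE combE yE uE.
Qed.

End TorsionlessReflexive.

(** * The equivalences *)

Theorem theorem4p8 (R : comPzRingType) (hR : noetherian R) :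
  [/\ (gorenstein R /\ krull_dim_le R 1) <->
      (forall M : lmodType R, torsionless M -> reflexive_module M),
      (gorenstein R /\ krull_dim_le R 1) <->
      (forall M : lmodType R, torsionless M -> trace_via (@biduality R M))
    & is_domain R ->
      ((gorenstein R /\ krull_dim_le R 1) <->
       (forall M : lmodType R, torsionless M ->
          exists (X : lmodType R) (phi : {linear M -> X}),
            preenvelope (@reflexive_module R) phi /\ trace_up_to_iso M X))].
Proof.
have i_ii : gorenstein R /\ krull_dim_le R 1 <->
    (forall M : lmodType R, torsionless M -> reflexive_module M).
  split=> [[Rgor dimR] M|refl].
    by apply: ext_vanish_reflexive => //; apply: gorenstein_ext_vanish.
  have R1 := reflexive_ext_vanish hR refl.
  by split; [apply: ext_vanish_gorenstein|apply: krull_dim_le1].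
split=> //.
- rewrite i_ii; split=> [refl M Mtl|tr M Mtl].
    split; first by case: Mtl.
    apply: trace_submodule_self; apply/seteqP; split=> // Phi _.
    have [_ [g _ gK]] := refl M Mtl.
    by exists (g Phi) => //; apply: gK.
  (* The factor [R] supplies a functional with value 1, which makes the trace embedding of [M * R]
     surjective; reflexivity then passes to the retract [M]. *)
  have pairtl := torsionless_pair Mtl; have pairtr := tr _ pairtl.
  apply: (reflexive_retract (i := linear_map (@pair_inl_linear _ M R^o)) (r :=
    fst)) => //.
  split; first by case: pairtl.
  apply: bijective_of; first by case: pairtr.
  exact: (@trace_via_surj R _ _ _ (snd : {linear (M * R^o)%type -> R^o}) (0, 1) erefl pairtr).
move=> _; rewrite i_ii; split=> [refl M Mtl|env M Mtl].
  exists M, (idfun : {linear M -> M}); split.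
    by split=> [|X psi _]; [apply: refl|exists psi].
  exists (idfun : {linear M -> M}); split; first by [].
  by apply: trace_submodule_self; apply/seteqP; split=> // x _; exists x.
have [X [phi [[Xref _] [iota tr]]]] := env _ (torsionless_pair Mtl).
exact: reflexive_of_trace tr Xref.
Qed.
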